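(* Every three-dimensional hyperbolicity cone is a spectrahedron. Explicitly: let $f\in\mathbb{R}[x,y,z]$ be a homogeneous polynomial that is hyperbolic with respect to $e\in\mathbb{R}^3$, and let $$C(f,e)=\{a\in\mathbb{R}^3 : f(te-a)\ne 0\ \text{for all real } t\le 0\}.$$ Then there exist an integer $m\ge1$ and real symmetric $m\times m$ matrices $N_0,N_1,N_2$ such that the closure of $C(f,e)$ in $\mathbb{R}^3$ equals $$\{a\in\mathbb{R}^3 : a_0N_0+a_1N_1+a_2N_2\ \text{is positive semidefinite}\}.$$
   Context: A homogeneous polynomial $f\in\mathbb{R}[x,y,z]$ is hyperbolic with respect to $e\in\mathbb{R}^3$ if $f(e)\ne0$ and for every $a\in\mathbb{R}^3$ all roots of the univariate polynomial $f(te+a)\in\mathbb{R}[t]$ are real. The set $C(f,e)$ is the hyperbolicity cone of $f$ with respect to $e$; it is the connected component of $e$ in the complement of the real zero set of $f$ in $\mathbb{R}^3$. A spectrahedral cone is a linear slice of the cone of positive semidefinite real symmetric matrices, i.e. a set of the form displayed last in the claim. *)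

(* Defs.v *)
From HB Require Import structures.
From mathcomp Require Import all_boot all_order all_algebra.
From mathcomp Require Import complex.
From mathcomp Require Import all_classical all_reals all_analysis.
(* Without the notations of mpoly, which clash with those of mathcomp-analysis. *)
From mathcomp Require Export (canonicals, coercions) mpoly.
Export numFieldNormedType.Exports.

Set Implicit Arguments.
Unset Strict Implicit.
Unset Printing Implicit Defensive.

Import Order.TTheory GRing.Theory Num.Theory.

Local Open Scope ring_scope.
Local Open Scope classical_set_scope.

Notation "{ 'poly3' R }" := (mpoly.mpoly 3 R) (format "{ 'poly3'  R }").

Definition homogeneous (R : realType) (f : {poly3 R}) : Prop :=
  f \is mpoly.ishomog mpoly.mdeg.

Definition eval3 (R : realType) (f : {poly3 R}) (v : 'rV[R]_3) : R :=
  mpoly.meval (fun i => v 0 i) f.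

(* The univariate polynomial f(te + a), with 'X standing for t. *)
Definition line_poly (R : realType) (f : {poly3 R}) (e a : 'rV[R]_3)
  : {poly R} :=
  mpoly.mmap polyC (fun i => e 0 i *: 'X + (a 0 i)%:P) f.

Definition real_rooted (R : realType) (p : {poly R}) : Prop :=
  forall z : complex R, root (map_poly (real_complex R) p) z ->
    complex.Im z = 0.

Definition hyperbolic (R : realType) (f : {poly3 R}) (e : 'rV[R]_3) : Prop :=
  eval3 f e != 0 /\ forall a : 'rV[R]_3, real_rooted (line_poly f e a).

Definition hyperbolicity_cone (R : realType) (f : {poly3 R}) (e : 'rV[R]_3)
  : set 'rV[R]_3 :=
  [set a | forall t : R, t <= 0 -> eval3 f (t *: e - a) != 0].

Definition psdmx (R : realType) (m : nat) (A : 'M[R]_m) : Prop :=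
  A^T = A /\ forall v : 'rV[R]_m, 0 <= (v *m A *m v^T) 0 0.

(* Main.v *)
From HB Require Import structures.
Require Import Defs.
From mathcomp Require Import all_boot all_order all_algebra.
From mathcomp Require Import separable cyclic cyclotomic polyXY complex.
From mathcomp Require Import ring lra zify.
From mathcomp Require Import all_classical all_reals all_analysis.

Set Implicit Arguments.
Unset Strict Implicit.
Unset Printing Implicit Defensive.

Import Order.TTheory GRing.Theory Num.Theory.

Local Open Scope ring_scope.
Local Open Scope classical_set_scope.

(** Write a point of the space as tau e + x b1 + y b2.  For z = x + i y of
    modulus 1, hyperbolicity says that f(t e + x b1 + y b2) has only real roots
    t, and the point lies in the closed cone exactly when tau is at least the
    largest of them.  Put s = z t and w = z^2: the roots then sweep a plane
    curve F(s, w) = 0 ([curve_poly]), monic in s of degree n = deg f, on which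
    |w| = 1 forces s to be w times its own conjugate ([curve_poly_real]).

    Polynomials in s and w carry the positive semidefinite form [curve_form]:
    the mean over |w| = 1 of the sum over the fibre of Re (conj p * q).  The
    mean is algebraic, because the power sums of the roots are polynomials in w
    ([fibre_sum_poly]).  For this form multiplication by w is an isometry, and
    multiplication by s satisfies b (w p, s q) = b (s p, q).  In the completed
    space H, let E be the orthogonal complement of w H.  Then H is the
    orthogonal sum of the w^j E, and the relation for s leaves only two
    diagonals: s acts on H as the Toeplitz operator with symbol S0 + w S0',
    where S0' is the adjoint of S0.  Hence conj z * s, whose values on the fibre
    over w are the roots t, becomes the hermitian pencil conj z * S0 + z * S0',
    which is linear in (x, y).  Now E is the space of constant terms p(s, 0) in
    disguise, with norm G (u, u) = inf { b (p, p) : p (s, 0) = u }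
    ([min_form]), and S0 is multiplication by s there.  So the cone is
    described by tau G (u, u) >= 2 Re (conj z * G (u, s u)).  Since G vanishes
    on the multiples of F(s, 0), it is enough to let u range over the
    polynomials of degree less than n, and a basis of these over the reals
    turns the inequality into a linear matrix inequality of size 2n.

    The proof stays with polynomials: those almost orthogonal to w H
    ([near_min]) play the role of E, and both the bound on the roots at a given
    point of the circle and the inequality for G are compared with the
    positivity of one quadratic form on polynomials, [peak_form], in which the
    extra term C |q - conj w0 * w q|^2 makes everything away from w0 harmless:
    - [compression_le_iff_peak_form] treats G.  One direction inserts
      p + W p + ... + W^N p with p almost minimal, the other expands an
      arbitrary polynomial as a finite sum of W^j p_j with p_j almost minimal
      ([near_min_decomposition]).
    - [peak_form_ge0] and [bound_of_peak_form] treat the roots.  Positivity is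
      checked fibre by fibre, because large roots occur only away from w0
      ([fibre_gap]); conversely a Fejer sum concentrates at w0
      ([fejer_sum]). *)

(** * Limits by inequalities *)

(** Errors will be of the form K e^2 + L e, with e a precision that can be chosen
    at will. *)
Lemma le0_of_le_small (R : realType) (x K L : R) :
  (forall e, 0 < e -> e <= 1 -> x <= K * e ^+ 2 + L * e) -> x <= 0.
Proof.
move=> h; rewrite leNgt; apply/negP => x0.
pose T := `|K| + `|L| + 1 + x.
have T0 : 0 < T by rewrite /T; have := normr_ge0 K; have := normr_ge0 L; lra.
pose e := x / (2 * T).
have e0 : 0 < e by rewrite divr_gt0 // mulr_gt0.
have e1 : e <= 1.
  rewrite ler_pdivrMr ?mulr_gt0 // mul1r /T.
  have := normr_ge0 K; have := normr_ge0 L; lra.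
have := h _ e0 e1; apply/negP; rewrite -ltNge.
have e2 : e ^+ 2 <= e by rewrite expr2 ler_piMr // ltW.
have eT : T * e = x / 2 by rewrite /e; field; rewrite gt_eqF.
have h1 : K * e ^+ 2 <= `|K| * e.
  apply: (le_trans (ler_norm _)); rewrite normrM ler_wpM2l //.
  by rewrite ger0_norm // sqr_ge0.
have h2 : L * e <= `|L| * e by apply: ler_wpM2r; [exact: ltW | exact: ler_norm].
have h3 : 0 < x * e by rewrite mulr_gt0.
rewrite /T !mulrDl in eT.
nra.
Qed.

Lemma eq0_of_le_small (R : realType) (x K L : R) :
  (forall e, 0 < e -> e <= 1 -> `|x| <= K * e ^+ 2 + L * e) -> x = 0.
Proof. by move=> /le0_of_le_small; rewrite normr_le0 => /eqP. Qed.

Lemma ge0_of_le_linear (R : realType) (x c : R) :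
  (forall N : nat, 0 <= N%:R * x + c) -> 0 <= x.
Proof.
move=> h; rewrite leNgt; apply/negP => x0.
have := h (Num.truncn (c / - x)).+1; apply/negP; rewrite -ltNge.
have := Num.Theory.truncnS_gt (c / - x); rewrite ltr_pdivrMr ?oppr_gt0 // mulrN; lra.
Qed.

(** * Positive semidefinite forms *)

Section SemiInner.
Variables (R : realType) (P : lmodType R) (b : P -> P -> R).

Record semi_inner : Prop := SemiInner {
  siC : forall x y, b x y = b y x;
  siD : forall x y z, b x (y + z) = b x y + b x z;
  siZ : forall c x y, b x (c *: y) = c * b x y;
  si_ge0 : forall x, 0 <= b x x }.

Definition seminorm (x : P) : R := Num.sqrt (b x x).

Hypothesis bP : semi_inner.

Lemma siDl x y z : b (x + y) z = b x z + b y z.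
Proof. by rewrite (siC bP) (siD bP) !(siC bP z). Qed.

Lemma siZl c x y : b (c *: x) y = c * b x y.
Proof. by rewrite (siC bP) (siZ bP) (siC bP y). Qed.

Lemma siNr x y : b x (- y) = - b x y.
Proof. by rewrite -scaleN1r (siZ bP) mulN1r. Qed.

Lemma siNl x y : b (- x) y = - b x y.
Proof. by rewrite (siC bP) siNr (siC bP y). Qed.

Lemma si0r x : b x 0 = 0.
Proof. by rewrite -(scale0r 0) (siZ bP) mul0r. Qed.

Lemma si0l x : b 0 x = 0.
Proof. by rewrite (siC bP) si0r. Qed.

Lemma si_sumr I (r : seq I) (Q : pred I) (F : I -> P) x :
  b x (\sum_(i <- r | Q i) F i) = \sum_(i <- r | Q i) b x (F i).
Proof. by apply: (big_morph (b x) (siD bP x) (si0r x)). Qed.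

Lemma si_suml I (r : seq I) (Q : pred I) (F : I -> P) x :
  b (\sum_(i <- r | Q i) F i) x = \sum_(i <- r | Q i) b (F i) x.
Proof. by rewrite (siC bP) si_sumr; apply: eq_bigr => i _; rewrite (siC bP). Qed.

Lemma seminorm_ge0 x : 0 <= seminorm x.
Proof. exact: sqrtr_ge0. Qed.

Lemma seminorm_sqr x : seminorm x ^+ 2 = b x x.
Proof. by rewrite sqr_sqrtr ?(si_ge0 bP). Qed.

Lemma si_quad x y t :
  b (x + t *: y) (x + t *: y) = b x x + 2 * t * b x y + t ^+ 2 * b y y.
Proof.
rewrite !(siD bP) !siDl !(siZ bP) !siZl (siC bP y x); ring.
Qed.

(** When b y y = 0 the quadratic in t degenerates to an affine function, which
    is bounded below only if b x y = 0. *)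
Lemma si_cauchy x y : `|b x y| <= seminorm x * seminorm y.
Proof.
rewrite -(@ler_pXn2r _ 2) ?nnegrE ?mulr_ge0 ?seminorm_ge0 //.
rewrite real_normK ?num_real // exprMn !seminorm_sqr.
have h t : 0 <= b x x + 2 * t * b x y + t ^+ 2 * b y y.
  by rewrite -si_quad (si_ge0 bP).
have yy0 := si_ge0 bP y.
have [y0|y0] := eqVneq (b y y) 0; last first.
  have := h (- b x y / b y y).
  have -> : b x x + 2 * (- b x y / b y y) * b x y
    + (- b x y / b y y) ^+ 2 * b y y = (b x x * b y y - b x y ^+ 2) / b y y.
    by field.
  by rewrite pmulr_lge0 ?invr_gt0 ?lt_def ?y0 // subr_ge0.
rewrite y0 mulr0.
have [->|n0] := eqVneq (b x y) 0; first by rewrite expr0n.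
have := h (- (b x x + 1) / (2 * b x y)); rewrite y0 mulr0 addr0.
have -> : b x x + 2 * (- (b x x + 1) / (2 * b x y)) * b x y = - 1.
  by field.
by rewrite lerNr oppr0 ler10.
Qed.

Lemma seminormD x y : seminorm (x + y) <= seminorm x + seminorm y.
Proof.
rewrite -(@ler_pXn2r _ 2) ?nnegrE ?addr_ge0 ?seminorm_ge0 //.
rewrite sqrrD !seminorm_sqr (siD bP) !siDl (siC bP y x).
have := le_trans (ler_norm _) (si_cauchy x y).
by rewrite mulr2n; lra.
Qed.

Lemma seminormN x : seminorm (- x) = seminorm x.
Proof. by rewrite /seminorm siNr siNl opprK. Qed.

End SemiInner.

(** * The form of minimal energies *)

Section MinimalForm.
Variables (R : realType) (P V : lmodType R) (b : P -> P -> R).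
Variable (ct : {linear P -> V}).

Definition min_energy (u : V) : R := inf [set b p p | p in [set p | ct p = u]].

(** The polarization of [min_energy]. *)
Definition min_form (u x : V) : R :=
  (min_energy (u + x) - min_energy u - min_energy x) / 2.

Variable W : {additive P -> P}.

(** An e-approximate orthogonality to the range of W.  It amounts to minimality
    of the energy, up to e^2, in the fibre of ct ([near_min_exists],
    [near_min_energy]), and in this form it is visibly stable under sums. *)
Definition near_min (e : R) (p : P) : Prop :=
  forall r, `|b (W r) p| <= e * seminorm b r.

(** An abstract Hardy space: W is multiplication by the coordinate of the disc,
    ct takes the constant term.  The bands of [shift_band] come from
    densities that are Laurent polynomials. *)
Record shift_system : Prop := ShiftSystem {
  shift_si : semi_inner b;
  shift_iso : forall p q, b (W p) (W q) = b p q;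
  shift_surj : forall u, exists p, ct p = u;
  shift_ct : forall p, ct (W p) = 0;
  shift_ker : forall p, ct p = 0 -> exists r, p = W r;
  shift_band : forall p, exists J, forall q, b p (iter J W q) = 0 }.

Hypothesis sP : shift_system.
Let bP := shift_si sP.
Let bC := siC bP.

Lemma near_minW e e' p : near_min e p -> e <= e' -> near_min e' p.
Proof.
move=> h ee r; apply: (le_trans (h r)); by rewrite ler_wpM2r ?seminorm_ge0.
Qed.

Lemma near_minD e e' p q :
  near_min e p -> near_min e' q -> near_min (e + e') (p + q).
Proof.
move=> hp hq r; rewrite (siD bP) mulrDl.
by apply: (le_trans (ler_normD _ _)); rewrite lerD.
Qed.

Lemma near_min_small e p : seminorm b p <= e -> near_min e p.
Proof.
move=> pe r; apply: (le_trans (si_cauchy bP _ _)).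
rewrite {1}/seminorm (shift_iso sP) -/(seminorm b r) mulrC.
by rewrite ler_wpM2r // seminorm_ge0.
Qed.

Lemma min_energy_lbound u :
  has_lbound [set b p p | p in [set p | ct p = u]].
Proof. by exists 0 => _ [p _ <-]; rewrite (si_ge0 bP). Qed.

Lemma min_energy_le p : min_energy (ct p) <= b p p.
Proof. by apply: ge_inf; [exact: min_energy_lbound | exists p]. Qed.

(** Take p with energy within e^2 of the infimum.  Moving p by t W r cannot gain
    more than e^2, and the optimal t turns this into the bound on b p (W r). *)
Lemma near_min_exists u e : 0 < e -> exists2 p, ct p = u & near_min e p.
Proof.
move=> e0.
have [|_ [p pu <-] pe] := @inf_adherent _ [set b p p | p in [set p | ct p = u]]
   (e ^+ 2) (exprn_gt0 _ e0); last 1 first.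
- exists p => // r.
  have h t : 0 <= e ^+ 2 + 2 * t * b p (W r) + t ^+ 2 * b r r.
    have := min_energy_le (p + t *: W r).
    rewrite linearD linearZ /= (shift_ct sP) scaler0 addr0 pu.
    rewrite (si_quad bP) (shift_iso sP) /min_energy; lra.
  rewrite bC -(@ler_pXn2r _ 2) ?nnegrE ?mulr_ge0 ?seminorm_ge0 ?(ltW e0) //.
  rewrite real_normK ?num_real // exprMn (seminorm_sqr bP).
  have [r0|r0] := eqVneq (b r r) 0.
    have := si_cauchy bP p (W r).
    rewrite {2}/seminorm (shift_iso sP) r0 sqrtr0 mulr0 normr_le0 => /eqP ->.
    by rewrite expr0n mulr0.
  have := h (- b p (W r) / b r r).
  have -> : e ^+ 2 + 2 * (- b p (W r) / b r r) * b p (W r)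
    + (- b p (W r) / b r r) ^+ 2 * b r r
     = (e ^+ 2 * b r r - b p (W r) ^+ 2) / b r r by field.
  by rewrite pmulr_lge0 ?invr_gt0 ?lt_def ?r0 ?(si_ge0 bP) // subr_ge0.
- split; last exact: min_energy_lbound.
  by have [p pu] := shift_surj sP u; exists (b p p); exists p.
Qed.

(** Any competitor is p + W r, with energy b p p + 2 b p (W r) + |r|^2, at least
    b p p - 2 e |r| + |r|^2. *)
Lemma near_min_energy e p : near_min e p -> b p p <= min_energy (ct p) + e ^+ 2.
Proof.
move=> hp; rewrite -lerBlDr; apply: lb_le_inf.
  by exists (b p p); exists p.
move=> _ [q qp <-].
have [r rE] : exists r, q - p = W r.
  by apply: (shift_ker sP); rewrite linearB /= qp subrr.
have -> : q = p + 1 *: W r by rewrite scale1r -rE addrC subrK.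
rewrite (si_quad bP) (shift_iso sP) bC -(seminorm_sqr bP r).
have := hp r; rewrite ler_norml => /andP[h _].
have := sqr_ge0 (e - seminorm b r); nra.
Qed.

Lemma near_min_pair e e' p p' : near_min e p -> near_min e' p' ->
  0 <= e -> 0 <= e' ->
  `|b p p' - min_form (ct p) (ct p')| <= (e + e') ^+ 2.
Proof.
move=> h h' e0 e0'.
have h2 := near_minD h h'.
have -> : b p p' = (b (p + p') (p + p') - b p p - b p' p') / 2.
  by rewrite !(siD bP) !(siDl bP) (bC p' p); field.
have := near_min_energy h; have := near_min_energy h'.
have := near_min_energy h2; have := min_energy_le p.
have := min_energy_le p'; have := min_energy_le (p + p').
rewrite (raddfD ct) /= /min_form ler_norml.
have : 0 <= e * e' by exact: mulr_ge0.
move=> *; apply/andP; split; nra.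
Qed.

(** One near-minimizer is enough: replacing q by a near-minimizer with the same
    constant term changes q by some W r, to which p is almost orthogonal.  This
    makes [min_form] a limit of values of b, and so bilinear. *)
Lemma near_min_form e p q : 0 <= e -> near_min e p ->
  `|b p q - min_form (ct p) (ct q)| <= e ^+ 2 + 2 * e * seminorm b q.
Proof.
move=> e0 hp; rewrite -subr_le0.
apply: (@le0_of_le_small _ _ 1 (3 * e)) => d d0 d1.
have [p' p'q hp'] := near_min_exists (ct q) d0.
have h1 := near_min_pair hp hp' e0 (ltW d0); rewrite p'q in h1.
have [r rE] : exists r, q - p' = W r.
  by apply: (shift_ker sP); rewrite linearB /= p'q subrr.
have qE : b p q = b p p' + b (W r) p.
  by rewrite -rE (bC _ p) (siD bP) (siNr bP) addrC subrK.
have h2 := hp r.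
have nr : seminorm b r <= seminorm b q + seminorm b p'.
  rewrite -[seminorm b p'](seminormN bP).
  by rewrite {1}/seminorm -(shift_iso sP) -rE (seminormD bP).
have np' : seminorm b p' <= seminorm b q + d.
  rewrite -(@ler_pXn2r _ 2) ?nnegrE ?addr_ge0 ?seminorm_ge0 ?(ltW d0) //.
  rewrite sqrrD !(seminorm_sqr bP).
  have := near_min_energy hp'; have := min_energy_le q; rewrite p'q.
  have : 0 <= seminorm b q * d by rewrite mulr_ge0 ?seminorm_ge0 ?ltW.
  by rewrite mulr2n; lra.
have h3 : e * seminorm b r <= e * (2 * seminorm b q + d).
  by rewrite ler_wpM2l //; lra.
have : `|b p q - min_form (ct p) (ct q)| <=
  `|b p p' - min_form (ct p) (ct q)| + `|b (W r) p|.
  by rewrite qE addrAC ler_normD.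
have : (e + d) ^+ 2 = e ^+ 2 + 2 * e * d + d ^+ 2 by ring.
lra.
Qed.

Lemma min_formC u x : min_form u x = min_form x u.
Proof. by rewrite /min_form (addrC u); lra. Qed.

Lemma min_form_si : semi_inner min_form.
Proof.
split; first exact: min_formC.
- move=> u x y.
  have [q qx] := shift_surj sP x; have [q' q'y] := shift_surj sP y.
  apply/eqP; rewrite -subr_eq0; apply/eqP.
  apply: (@eq0_of_le_small _ _ 3
    (2 * (seminorm b (q + q') + seminorm b q + seminorm b q'))) => e e0 e1.
  have [p pu hp] := near_min_exists u e0.
  have := near_min_form (q + q') (ltW e0) hp.
  have := near_min_form q (ltW e0) hp.
  have := near_min_form q' (ltW e0) hp.
  rewrite (raddfD ct) /= qx q'y pu (siD bP) !ler_norml.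
  move=> /andP[? ?] /andP[? ?] /andP[? ?]; apply/andP; split; lra.
- move=> c u x.
  have [q qx] := shift_surj sP x.
  apply/eqP; rewrite -subr_eq0; apply/eqP.
  apply: (@eq0_of_le_small _ _ (1 + `|c|)
    (2 * (seminorm b (c *: q) + `|c| * seminorm b q))) => e e0 e1.
  have [p pu hp] := near_min_exists u e0.
  have h1 := near_min_form (c *: q) (ltW e0) hp.
  have h2 := near_min_form q (ltW e0) hp.
  have h3 : `|c * b p q - c * min_form u x|
     <= `|c| * (e ^+ 2 + 2 * e * seminorm b q).
    by rewrite -mulrBr normrM ler_wpM2l // -pu -qx.
  have cq : ct (c *: q) = c *: x by rewrite linearZ /= qx.
  move: h1; rewrite cq pu (siZ bP) => h1.
  have := ler_distD (c * b p q) (min_form u (c *: x)) (c * min_form u x).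
  rewrite [`|min_form u _ - c * b p q|]distrC; lra.
- move=> u; rewrite -oppr_le0.
  apply: (@le0_of_le_small _ _ 4 0) => e e0 e1.
  have [p pu hp] := near_min_exists u e0.
  have := near_min_pair hp hp (ltW e0) (ltW e0).
  have := si_ge0 bP p; rewrite pu ler_norml => ? /andP[? ?]; lra.
Qed.

Lemma min_form_le p : min_form (ct p) (ct p) <= b p p.
Proof.
rewrite -subr_le0; apply: (@le0_of_le_small _ _ 5 0) => e e0 e1.
have [p' p'p hp] := near_min_exists (ct p) e0.
have := near_min_pair hp hp (ltW e0) (ltW e0); rewrite p'p ler_norml.
have := near_min_energy hp; have := min_energy_le p; rewrite p'p.
move=> ? ? /andP[? ?]; lra.
Qed.

Lemma near_min_le e p : 0 <= e -> near_min e p ->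
  b p p <= min_form (ct p) (ct p) + 4 * e ^+ 2.
Proof.
move=> e0 h; have := near_min_pair h h e0 e0; rewrite ler_norml => /andP[]; lra.
Qed.

End MinimalForm.

(** * Compression of a multiplier to the constant terms *)

Section Toeplitz.
Variables (R : realType) (P V : lmodType R) (b : P -> P -> R).
Variables (ct : {linear P -> V}) (W S : {additive P -> P}).
Variables (sigma : {additive V -> V}) (rho : R).
Hypothesis sP : shift_system b ct W.
Let bP := shift_si sP.
Let bC := siC bP.

(** The relation [multiplier_adj] is the abstract form of s = w conj s on the
    curve; it is what leaves only two diagonals in the Gram matrix of
    [gram_mul]. *)
Record multiplier : Prop := Multiplier {
  multiplier_ge0 : 0 <= rho;
  multiplier_ct : forall p, ct (S p) = sigma (ct p);
  multiplier_shift : forall p, S (W p) = W (S p);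
  multiplier_adj : forall p q, b (W p) (S q) = b (S p) q;
  multiplier_bound : forall p, seminorm b (S p) <= rho * seminorm b p }.

Hypothesis mP : multiplier.
Local Notation G := (min_form b ct).
Local Notation nrm := (seminorm b).
Local Notation near_min := (near_min b W).

Let Gsi : semi_inner G := min_form_si sP.
Let GC := siC Gsi.

Lemma iter_shiftD j p q : iter j W (p + q) = iter j W p + iter j W q.
Proof. by elim: j => //= j ->; rewrite raddfD. Qed.

Lemma iter_shift_iso j p q : b (iter j W p) (iter j W q) = b p q.
Proof. by elim: j => //= j <-; rewrite (shift_iso sP). Qed.

Lemma iter_shift_mul j p : S (iter j W p) = iter j W (S p).
Proof. by elim: j => //= j <-; rewrite (multiplier_shift mP). Qed.

Lemma near_min_shift e M p q j : 0 <= e -> near_min e p -> nrm q <= M ->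
  `|b p (iter j.+1 W q)| <= e * M.
Proof.
move=> e0 hp qM; rewrite bC; apply: (le_trans (hp _)).
by rewrite ler_wpM2l // {1}/seminorm iter_shift_iso.
Qed.

Lemma mul_le p M : nrm p <= M -> nrm (S p) <= (1 + rho) * M.
Proof.
move=> pM; apply: (le_trans (multiplier_bound mP p)).
have := multiplier_ge0 mP; have := seminorm_ge0 b p; nra.
Qed.

Section Terms.
Variables (e M : R) (p q : P).
Hypotheses (e0 : 0 <= e) (hp : near_min e p) (hq : near_min e q).
Hypotheses (pM : nrm p <= M) (qM : nrm q <= M).

Let K := e ^+ 2 + 2 * e * ((1 + rho) * M).

Let M0 : 0 <= M := le_trans (seminorm_ge0 b p) pM.

Let eK : e * M <= K.
Proof.
rewrite /K; have := multiplier_ge0 mP; have := sqr_ge0 e.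
have : 0 <= e * M by exact: mulr_ge0.
move=> ? ? ?; have : 0 <= e * M * rho by exact: mulr_ge0.
lra.
Qed.

Let eK' : e * ((1 + rho) * M) <= K.
Proof.
rewrite /K; have := sqr_ge0 e.
have : 0 <= e * ((1 + rho) * M).
  by rewrite !mulr_ge0 // addr_ge0 // (multiplier_ge0 mP).
lra.
Qed.

Lemma near_min_form_le x y : nrm y <= (1 + rho) * M -> near_min e x ->
  `|b x y - G (ct x) (ct y)| <= K.
Proof.
move=> yM hx; apply: (le_trans (near_min_form sP _ e0 hx)).
by rewrite /K lerD2l ler_wpM2l ?mulr_ge0.
Qed.

Let MM : M <= (1 + rho) * M.
Proof. by rewrite mulrDl mul1r lerDl mulr_ge0 // (multiplier_ge0 mP). Qed.

(** Near-minimizers behave like the wandering subspace: different shifts of them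
    are almost orthogonal. *)
Lemma gram_shift j l : `|b (iter j W p) (iter l W q)
    - (if j == l then G (ct p) (ct q) else 0)| <= K.
Proof.
have [jl|jl|->] := ltngtP.
- rewrite subr0 -[in iter l _](subnKC jl) addSnnS iterD iter_shift_iso.
  by apply: le_trans eK; exact: near_min_shift.
- rewrite subr0 -[in iter j _](subnKC jl) addSnnS iterD iter_shift_iso bC.
  by apply: le_trans eK; exact: near_min_shift.
- by rewrite iter_shift_iso; apply: near_min_form_le => //; exact: le_trans MM.
Qed.

(** In the completed space this is S = S0 + W S0', with S0' the adjoint of S0.
    For j < l the common powers of W cancel and leave p against a shift of S q;
    for j > l one W is traded for an S on the left by [multiplier_adj], which leaves
    a shift in front unless j = l + 1. *)
Lemma gram_mul j l : `|b (iter j W p) (iter l W (S q))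
    - (if j == l then G (ct p) (sigma (ct q))
       else if j == l.+1 then G (sigma (ct p)) (ct q) else 0)| <= K.
Proof.
have SpM := mul_le pM; have SqM := mul_le qM.
have [jl|jl|->] := ltngtP.
- rewrite ltn_eqF ?ltnS 1?ltnW // subr0.
  rewrite -[in iter l _](subnKC jl) addSnnS iterD iter_shift_iso.
  by apply: le_trans eK'; exact: near_min_shift.
- rewrite -[in iter j _](subnKC jl) addSnnS iterD iter_shift_iso iterS.
  rewrite (multiplier_adj mP) iter_shift_mul.
  have [k0|k0] := posnP (j - l.+1)%N.
    have -> : j = l.+1 by apply/eqP; rewrite eqn_leq jl -subn_eq0 k0 eqxx.
    by rewrite eqxx subnn /= bC (GC (sigma _)) -(multiplier_ct mP); exact: near_min_form_le.
  have jl1 : (l.+1 < j)%N by rewrite -subn_gt0.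
  rewrite (gtn_eqF jl1) subr0 -(prednK k0) bC.
  by apply: le_trans eK'; exact: near_min_shift.
- by rewrite iter_shift_iso -(multiplier_ct mP); exact: near_min_form_le.
Qed.

End Terms.

(** In the application the last term is C |1 - conj w0 * w|^2 times the density
    of q, so it penalizes mass away from w = w0. *)
Definition peak_form (t C : R) (q : P) : R :=
  t * b q q - 2 * b q (S q) + C * b (q - W q) (q - W q).

(** What the (j, l) entry of [peak_form] at a sum of W^j p_j becomes when the
    p_j, of constant terms y_j, are exact minimizers. *)
Definition toeplitz_term (t C : R) (y : nat -> V) (j l : nat) : R :=
  (if j == l then (t + 2 * C) * G (y l) (y l) - 2 * G (y l) (sigma (y l)) else 0)
  - (if j == l.+1 then 2 * G (sigma (y l.+1)) (y l) + 2 * C * G (y l.+1) (y l) else 0).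

(** A and B depend on J and on the bound M of the norms only, so e can go to 0
    while the p_j vary. *)
Lemma peak_form_toeplitz (J : nat) (t C M : R) : exists A B : R,
  forall (e : R) (p : nat -> P), 0 <= e ->
  (forall j, (j < J)%N -> near_min e (p j) /\ nrm (p j) <= M) ->
  `|peak_form t C (\sum_(j < J) iter j W (p j))
    - \sum_(j < J) \sum_(l < J) toeplitz_term t C (fun j => ct (p j)) j l|
   <= A * e ^+ 2 + B * e.
Proof.
pose c := `|t + 2 * C| + 2 + `|2 * C|.
exists (\sum_(j < J) \sum_(l < J) c),
   (\sum_(j < J) \sum_(l < J) c * (2 * ((1 + rho) * M))) => e p e0 hp.
pose K := e ^+ 2 + 2 * e * ((1 + rho) * M).
pose f j l := (t + 2 * C) * b (iter j W (p j)) (iter l W (p l))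
   - 2 * b (iter j W (p j)) (iter l W (S (p l)))
   - 2 * C * b (iter j W (p j)) (iter l.+1 W (p l)).
set q := \sum_(j < J) _.
have -> : peak_form t C q = \sum_(j < J) \sum_(l < J) f j l.
  have -> : peak_form t C q
     = (t + 2 * C) * b q q - 2 * b q (S q) - 2 * C * b q (W q).
    rewrite /peak_form !(siD bP) !(siDl bP) !(siNr bP) !(siNl bP).
    by rewrite (shift_iso sP) (bC (W q) q); ring.
  rewrite /q raddf_sum [W _]raddf_sum /= !(si_suml bP) !mulr_sumr -!sumrB.
  apply: eq_bigr => j _; rewrite !(si_sumr bP) !mulr_sumr -!sumrB.
  by apply: eq_bigr => l _; rewrite iter_shift_mul.
rewrite -sumrB; apply: (le_trans (ler_norm_sum _ _ _)).
rewrite !mulr_suml -big_split /=; apply: ler_sum => j _.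
rewrite -sumrB; apply: (le_trans (ler_norm_sum _ _ _)).
rewrite -big_split /=; apply: ler_sum => l _.
have [hj jM] := hp j (ltn_ord j); have [hl lM] := hp l (ltn_ord l).
have h1 := gram_shift e0 hj hl jM lM j l.
have h2 := gram_mul e0 hj hl jM lM j l.
have h3 := gram_shift e0 hj hl jM lM j l.+1.
have -> : c * e ^+ 2 + c * (2 * ((1 + rho) * M)) * e
  = `|t + 2 * C| * K + 2 * K + `|2 * C| * K by rewrite /c /K; ring.
set g1 := (X in _ - X) in h1; set g2 := (X in _ - X) in h2.
set g3 := (X in _ - X) in h3.
have -> : toeplitz_term t C (fun j => ct (p j)) j l
   = (t + 2 * C) * g1 - 2 * g2 - 2 * C * g3.
  rewrite /toeplitz_term /g1 /g2 /g3.
  have [->|jl] := eqVneq (j : nat) l; first by rewrite ltn_eqF //; ring.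
  by have [->|jl'] := eqVneq (j : nat) l.+1; ring.
have -> : f j l - ((t + 2 * C) * g1 - 2 * g2 - 2 * C * g3)
 = (t + 2 * C) * (b (iter j W (p j)) (iter l W (p l)) - g1)
   - 2 * (b (iter j W (p j)) (iter l W (S (p l))) - g2)
   - 2 * C * (b (iter j W (p j)) (iter l.+1 W (p l)) - g3).
  by rewrite /f; ring.
apply: (le_trans (ler_normB _ _)); apply: lerD; last first.
  by rewrite normrM ler_wpM2l.
apply: (le_trans (ler_normB _ _)); apply: lerD.
  by rewrite normrM ler_wpM2l.
by rewrite normrM (ger0_norm (ler0n _ 2)) ler_wpM2l.
Qed.

Lemma toeplitz_col t C y J l : (l < J)%N ->
  \sum_(j < J) toeplitz_term t C y j l
  = (t + 2 * C) * G (y l) (y l) - 2 * G (y l) (sigma (y l))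
   - (if (l.+1 < J)%N
      then 2 * G (sigma (y l.+1)) (y l) + 2 * C * G (y l.+1) (y l) else 0).
Proof.
have pick k a : \sum_(j < J) (if (j : nat) == k then a else 0)
    = if (k < J)%N then a else 0 :> R.
  rewrite -big_mkcond /=; case: ifP => kJ.
    by rewrite (big_pred1 (Ordinal kJ)) // => j; rewrite /= -val_eqE.
  by rewrite big_pred0 // => j; apply: contraFF kJ => /eqP <-.
by move=> lJ; rewrite sumrB !pick lJ.
Qed.

(** The numerical range of the symmetrized compression of S is bounded by tau.
    The factor 2 stands for the two diagonals: at the peak, S0 and its adjoint
    contribute equally. *)
Definition compression_le (tau : R) : Prop :=
  forall u, 2 * G u (sigma u) <= tau * G u u.

Lemma min_form_mul u : G (sigma u) (sigma u) <= rho ^+ 2 * G u u.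
Proof.
rewrite -subr_le0; apply: (@le0_of_le_small _ _ (rho ^+ 2 * 4) 0) => e e0 e1.
have [p <- hp] := near_min_exists sP u e0.
have h1 := near_min_le sP (ltW e0) hp.
have := min_form_le sP (S p); rewrite (multiplier_ct mP) => h2.
have h3 : b (S p) (S p) <= rho ^+ 2 * b p p.
  rewrite -!(seminorm_sqr bP) -exprMn ler_pXn2r ?nnegrE ?mulr_ge0
    ?seminorm_ge0 ?(multiplier_ge0 mP) //.
  exact: multiplier_bound.
have := ler_wpM2l (sqr_ge0 rho) h1; lra.
Qed.

(** The cross term of y_l and y_(l+1) is compared with its value at y_(l+1) =
    y_l.  The error is linear in d = y_(l+1) - y_l, hence absorbed by eta |y_l|^2
    and C |d|^2.  What remains is a telescoping sum.  The inequality also holds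
    for y_(l+1) = 0, which handles the end of the sum. *)
Lemma toeplitz_ge0 tau eta C y J : compression_le tau -> 0 < eta -> rho ^+ 2 / eta <= C ->
  0 <= \sum_(j < J) \sum_(l < J) toeplitz_term (2 * tau + eta) C y j l.
Proof.
move=> hL eta0 hC; rewrite exchange_big /=.
have C0 : 0 <= C by apply: le_trans hC; rewrite divr_ge0 ?sqr_ge0 ?ltW.
have cross y' x : 2 * G (sigma y') x + 2 * C * G y' x
    <= 2 * G x (sigma x) + eta * G x x + C * G y' y' + C * G x x.
  have [d ->] : exists d, y' = x + d by exists (y' - x); rewrite addrC subrK.
  rewrite raddfD !(siD Gsi) !(siDl Gsi) (GC (sigma x) x) (GC d x).
  have h1 := min_form_mul d.
  have h2 : 2 * G (sigma d) x <= eta * G x x + eta^-1 * G (sigma d) (sigma d).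
    have := si_ge0 Gsi (sigma d + (- eta) *: x).
    rewrite (si_quad Gsi) => h.
    rewrite -(ler_pM2l eta0) mulrDr mulVKf ?gt_eqF //.
    by move: h; rewrite sqrrN; lra.
  have h3 : eta^-1 * G (sigma d) (sigma d) <= C * G d d.
    apply: (@le_trans _ _ (rho ^+ 2 / eta * G d d)).
      by rewrite [_ / eta]mulrC -mulrA ler_wpM2l ?invr_ge0 ?(ltW eta0).
    by rewrite ler_wpM2r // (si_ge0 Gsi).
  lra.
pose h l := if (l < J)%N then G (y l) (y l) else 0.
apply: (@le_trans _ _ (\sum_(l < J) (C * (h l - h l.+1)))).
  rewrite -mulr_sumr mulr_ge0 // -(big_mkord xpredT (fun l => h l - h l.+1)).
  rewrite -(opprK (\sum_(_ <= _ < _) _)) -sumrN.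
  rewrite (eq_bigr (fun l => h l.+1 - h l)); last by move=> l _; rewrite opprB.
  rewrite telescope_sumr // opprB /h ltnn subr0; case: ifP => // _.
  exact: (si_ge0 Gsi).
apply: ler_sum => l _; rewrite (toeplitz_col _ _ _ (ltn_ord l)) /h ltn_ord.
have := hL (y l); have := cross 0 (y l); have := cross (y l.+1) (y l).
rewrite raddf0 !(si0l Gsi); case: ifP => _; lra.
Qed.

(** Subtracting from q a near-minimizer with the same constant term leaves W r,
    and the process restarts at r.  The norms may grow, but only by a factor 4
    at each step, whatever e is. *)
Lemma peel q J e : 0 < e -> e <= 1 -> exists (p : nat -> P) (r : P),
  [/\ q = \sum_(j < J) iter j W (p j) + iter J W r,
   forall j, (j < J)%N -> near_min e (p j) /\ nrm (p j) <= 4 ^+ J * (nrm q + 1) &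
   nrm r <= 4 ^+ J * (nrm q + 1)].
Proof.
move=> e0 e1; elim: J => [|J [p [r [qE hp hr]]]].
  exists (fun=> 0), q; split=> //; first by rewrite big_ord0 add0r.
  by rewrite expr0 mul1r lerDl.
set N := 4 ^+ J * (nrm q + 1) in hp hr *.
have N1 : 1 <= N.
  have n0 := seminorm_ge0 b q.
  have : 1 <= (4 : R) ^+ J by apply: exprn_ege1; rewrite ler1n.
  by rewrite /N; nra.
have NS : 4 ^+ J.+1 * (nrm q + 1) = 4 * N by rewrite exprS mulrA.
have [p' p'r hp'] := near_min_exists sP (ct r) e0.
have [r' rE] : exists r', r - p' = W r'.
  by apply: (shift_ker sP); rewrite linearB /= p'r subrr.
have np' : nrm p' <= N + 2.
  rewrite -(@ler_pXn2r _ 2) ?nnegrE ?addr_ge0 ?seminorm_ge0 ?(le_trans ler01) //.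
  rewrite (seminorm_sqr bP).
  have := near_min_le sP (ltW e0) hp'; have := min_form_le sP r.
  rewrite p'r -(seminorm_sqr bP r).
  have := seminorm_ge0 b r; nra.
have nr' : nrm r' <= N + (N + 2).
  rewrite /seminorm -(shift_iso sP) -rE -/(nrm _).
  by apply: (le_trans (seminormD bP _ _)); rewrite (seminormN bP) lerD.
exists (fun j => if (j < J)%N then p j else p'), r'; rewrite NS; split; last by lra.
  rewrite big_ord_recr /= ltnn -addrA -iterS iterSr -iter_shiftD -rE.
  rewrite (addrC p') subrK [LHS]qE; congr (_ + _).
  by apply: eq_bigr => j _; rewrite ltn_ord.
move=> j _; case: ifP => [jJ|_]; last by split=> //; lra.
by have [? ?] := hp j jJ; split=> //; lra.
Qed.

(** After J steps, J the band width of q, the remainder W^J r is orthogonal to q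
    and almost orthogonal to all the W^j p_j, hence small.  A small vector is a
    near-minimizer ([near_min_small]), so the remainder is one more term and the
    decomposition is exact. *)
Lemma near_min_decomposition q : exists (J : nat) (M : R), forall e, 0 < e -> e <= 1 ->
  exists p : nat -> P, q = \sum_(j < J) iter j W (p j) /\
   forall j, (j < J)%N -> near_min e (p j) /\ nrm (p j) <= M.
Proof.
have [J qJ] := shift_band sP q.
exists J.+1, (4 ^+ J * (nrm q + 1)) => e e0 e1.
(* The remainder is bounded by J times the precision, hence the division. *)
pose e' := e / J.+1%:R.
have e'0 : 0 < e' by rewrite divr_gt0.
have e'e : e' <= e.
  by rewrite ler_pdivrMr // ler_peMr ?ler1n // ltW.
have [p [r [qE hp hr]]] := peel q J e'0 (le_trans e'e e1).
have nr : nrm r <= J%:R * e'.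
  have [->|r0] := eqVneq (nrm r) 0; first by rewrite mulr_ge0 // ltW.
  have r0' : 0 < nrm r by rewrite lt_def r0 seminorm_ge0.
  rewrite -(ler_pM2r r0') -expr2 (seminorm_sqr bP) -(iter_shift_iso J).
  have -> : b (iter J W r) (iter J W r)
     = - \sum_(j < J) b (iter j W (p j)) (iter J W r).
    have := qJ r; rewrite {1}qE (siDl bP) (si_suml bP) => /eqP.
    by rewrite addrC addr_eq0 => /eqP.
  have -> : J%:R * e' * nrm r = \sum_(j < J) e' * nrm r.
    by rewrite sumr_const card_ord -mulrA mulr_natl.
  apply: (le_trans (ler_norm _)); rewrite normrN.
  apply: (le_trans (ler_norm_sum _ _ _)); apply: ler_sum => j _.
  have [hj _] := hp j (ltn_ord j).
  rewrite -[in iter J _](subnKC (ltn_ord j)) addSnnS iterD iter_shift_iso.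
  by apply: near_min_shift => //; exact: ltW.
exists (fun j => if (j < J)%N then p j else r); split.
  rewrite big_ord_recr /= ltnn [LHS]qE; congr (_ + _).
  by apply: eq_bigr => j _; rewrite ltn_ord.
move=> j _; case: ifP => [jJ|_].
  have [h1 h2] := hp j jJ; split=> //; exact: near_minW h1 e'e.
split=> //; apply: (near_min_small sP); apply: (le_trans nr).
rewrite /e' mulrCA ler_piMr ?(ltW e0) // ler_pdivrMr // mul1r ler_nat //.
Qed.

Theorem compression_le_iff_peak_form tau :
  compression_le tau <-> forall eta, 0 < eta ->
    exists C, forall q, 0 <= peak_form (2 * tau + eta) C q.
Proof.
split=> [hL eta eta0|hC u].
  exists (rho ^+ 2 / eta) => q; rewrite -oppr_le0.
  have [J [M hJ]] := near_min_decomposition q.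
  have [A [B hAB]] := peak_form_toeplitz J (2 * tau + eta) (rho ^+ 2 / eta) M.
  apply: (@le0_of_le_small _ _ A B) => e e0 e1.
  have [p [{1}-> hp]] := hJ e e0 e1.
  have := hAB e p (ltW e0) hp; rewrite ler_norml => /andP[+ _].
  have := @toeplitz_ge0 tau eta (rho ^+ 2 / eta) (fun j => ct (p j)) J hL eta0 (lexx _).
  lra.
rewrite -subr_le0.
apply: (@le0_of_le_small _ _ 0 (G u u / 2)) => eta eta0 _.
have [C hq] := hC eta eta0.
set t := 2 * tau + eta in hq *.
suff : 0 <= t * G u u - 4 * G u (sigma u) by rewrite /t; lra.
(* With all y_j = u the Toeplitz sum of size N + 1 has N + 1 diagonal terms a
   and N cross terms x. *)
pose a := (t + 2 * C) * G u u - 2 * G u (sigma u).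
pose x := 2 * G (sigma u) u + 2 * C * G u u.
have -> : t * G u u - 4 * G u (sigma u) = a - x.
  by rewrite /a /x (GC (sigma u)); ring.
apply: (@ge0_of_le_linear _ _ a) => N.
have -> : N%:R * (a - x) + a
    = \sum_(j < N.+1) \sum_(l < N.+1) toeplitz_term t C (fun=> u) j l.
  rewrite exchange_big /= (eq_bigr (fun l : 'I_N.+1 =>
     a - if (l.+1 < N.+1)%N then x else 0)); last first.
    by move=> l _; rewrite toeplitz_col.
  rewrite big_ord_recr /= ltnn subr0 (eq_bigr (fun=> a - x)).
    by rewrite sumr_const card_ord mulr_natl.
  by move=> l _; rewrite ltnS ltn_ord.
rewrite -oppr_le0.
have [A [B hAB]] := peak_form_toeplitz N.+1 t C (Num.sqrt (G u u + 4)).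
apply: (@le0_of_le_small _ _ A B) => e e0 e1.
have [p pu hp] := near_min_exists sP u e0.
have pM : nrm p <= Num.sqrt (G u u + 4).
  rewrite /seminorm ler_wsqrtr //.
  have := near_min_le sP (ltW e0) hp; rewrite pu; nra.
have := hAB e (fun=> p) (ltW e0) (fun _ _ => conj hp pM).
rewrite pu; have := hq (\sum_(j < N.+1) iter j W p).
rewrite ler_norml => ? /andP[_ +]; lra.
Qed.

End Toeplitz.

(** * Power sums of the roots of a monic polynomial *)

Section PowerSums.

(** Euler's formula.  Modulo p, a p' is the sum of a(x) p / (X - x) over the
    roots x, and p / (X - x) is monic of degree size rs - 1.  Roots
    count with multiplicity, and since p is monic the remainder also exists when
    its coefficients are polynomials in w, as in [fibre_sum_poly]. *)
Lemma euler_residue (K : fieldType) (rs : seq K) (a q r : {poly K}) :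
  let p := \prod_(x <- rs) ('X - x%:P) in
  a * p^`() = q * p + r -> (size r <= size rs)%N ->
  r`_(size rs).-1 = \sum_(x <- rs) a.[x].
Proof.
move=> p aE sr.
have [q' [r' [aE' sr' <-]]] : exists q' r' : {poly K},
    [/\ a * p^`() = q' * p + r', (size r' <= size rs)%N &
      r'`_(size rs).-1 = \sum_(x <- rs) a.[x]].
  rewrite /p {p aE sr}; elim: rs => [|x rs [q1 [r1 [aE1 sr1 r1E]]]].
    exists 0, 0; rewrite !big_nil derivC mulr0 mul0r addr0 size_poly0.
    by split=> //; rewrite coef0.
  rewrite !big_cons; set p1 : {poly K} := \prod_(_ <- rs) _ in aE1 *.
  have sp1 : size p1 = (size rs).+1 by rewrite size_prod_XsubC.
  have [c cE] : exists c, a - a.[x]%:P = c * ('X - x%:P).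
    by apply/factor_theorem; rewrite rootE !hornerE subrr.
  exists (c + q1), ((a.[x])%:P * p1 + ('X - x%:P) * r1); split.
  - have aE : a = c * ('X - x%:P) + a.[x]%:P by rewrite -cE subrK.
    rewrite derivM derivXsubC mul1r mulrDr [in X in _ + X]mulrCA aE1.
    by rewrite {1}aE; ring.
  - rewrite /= (leq_trans (size_polyD _ _)) // geq_max.
    rewrite mul_polyC (leq_trans (size_scale_leq _ _)) ?sp1 //=.
    by rewrite (leq_trans (size_polyMleq _ _)) // size_XsubC /= ltnS.
  - rewrite /= coefD coefCM mulrBl coefB coefCM coefXM.
    have -> : p1`_(size rs) = 1.
      have := monic_prod_XsubC rs xpredT id.
      by move=> /monicP; rewrite lead_coefE -/p1 sp1.
    rewrite mulr1 (_ : r1`_(size rs) = 0) ?mulr0 ?subr0; last first.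
      by apply/leq_sizeP: sr1.
    case: (rs) sr1 r1E => [|y s] sr1 r1E /=; last by rewrite -r1E.
    by rewrite big_nil.
suff -> : r = r' by [].
have pm : p \is monic by exact: monic_prod_XsubC.
have rr : r - r' = (q' - q) * p.
  by apply/eqP; rewrite mulrBl subr_eq addrAC -aE' aE; apply/eqP; ring.
apply/eqP; rewrite -subr_eq0; apply/eqP.
have [q0|n0] := eqVneq (q' - q) 0; first by rewrite rr q0 mul0r.
have: (size (r - r')%R <= size rs)%N.
  by rewrite (leq_trans (size_polyD _ _)) // size_polyN geq_max sr.
rewrite rr size_Mmonic // size_prod_XsubC addnS /= leqNgt.
by rewrite -{1}[size rs]add0n ltn_add2r lt0n size_poly_eq0 n0.
Qed.

Lemma fibre_sum_poly (K : fieldType) (F a : {poly {poly K}}) : F \is monic ->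
  exists P : {poly K}, forall w rs,
    map_poly (horner_eval w) F = \prod_(x <- rs) ('X - x%:P) ->
    \sum_(x <- rs) (map_poly (horner_eval w) a).[x] = P.[w].
Proof.
move=> Fm.
have E := Pdiv.RingMonic.rdivp_eq Fm (a * F^`()).
set q := Pdiv.CommonRing.rdivp _ _ in E.
set r := Pdiv.CommonRing.rmodp _ _ in E.
have sr : (size r < size F)%N.
  by rewrite Pdiv.CommonRing.ltn_rmodp monic_neq0.
exists r`_(size F).-2 => w rs Fw.
have sF : size F = (size rs).+1.
  rewrite -(size_prod_XsubC rs id) -Fw size_map_poly_id0 //.
  by rewrite (monicP Fm) rmorph1 oner_neq0.
rewrite -(@euler_residue _ rs _ (map_poly (horner_eval w) q)
   (map_poly (horner_eval w) r)).
- by rewrite coef_map sF.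
- by rewrite -Fw deriv_map -!rmorphM -rmorphD /= -E.
- by rewrite (leq_trans (size_poly _ _)) // -ltnS -sF.
Qed.

End PowerSums.

(** * Means over the unit circle *)

Section Circle.
Variable R : realType.
Local Notation C := R[i].
Implicit Types (w s : C) (p q : {poly {poly C}}).

Lemma unit_conjM w : `|w| = 1 -> w * w^* = 1.
Proof. by move=> w1; rewrite -normCK w1 expr1n. Qed.

(** On the curve the conjugate of w is 1 / w and that of s is s / w. *)
Lemma conj_bivariate p : exists (J : nat) (p' : {poly {poly C}}),
  forall w s, `|w| = 1 -> s = w * s^* ->
    w ^+ J * (p.[w%:P].[s])^* = p'.[w%:P].[s].
Proof.
pose Q (p : {poly {poly C}}) := exists (J : nat) (p' : {poly {poly C}}),
  forall w s, `|w| = 1 -> s = w * s^* ->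
    w ^+ J * (p.[w%:P].[s])^* = p'.[w%:P].[s].
have add p1 p2 : Q p1 -> Q p2 -> Q (p1 + p2).
  move=> [J1 [r1 h1]] [J2 [r2 h2]].
  exists (J1 + J2)%N, ('X ^+ J2 * r1 + 'X ^+ J1 * r2) => w s w1 sw.
  rewrite !hornerD rmorphD mulrDr !hornerM !hornerXn -!rmorphXn !hornerC.
  by rewrite -h1 // -h2 // exprD; ring.
rewrite -/(Q p); elim/poly_ind: p => [|p c [J [p' hp]]].
  by exists 0%N, 0 => w s _ _; rewrite !horner0 rmorph0 mulr0.
apply: (add).
  exists J.+1, p' => w s w1 sw.
  rewrite hornerM hornerX hornerM hornerC rmorphM /= mulrCA -hp //.
  by rewrite exprSr -[RHS]mulr1 -(unit_conjM w1); ring.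
rewrite -/(Q _); elim/poly_ind: c => [|c d [K [c' hc]]].
  by exists 0%N, 0 => w s _ _; rewrite !horner0 rmorph0 mulr0.
rewrite polyCD; apply: (add); last first.
  by exists 0%N, (d^*)%:P%:P => w s _ _; rewrite !hornerC mul1r.
exists K.+1, (c' * 'X%:P) => w s w1 sw.
rewrite polyCM !hornerM !hornerC rmorphM /= hornerX -hc // hornerC.
by rewrite exprSr -[RHS]mulrA [X in _ = _ * (_ * X)]sw; ring.
Qed.

Lemma bounded_bivariate p (r : C) : 0 <= r ->
  exists2 K : C, 0 <= K & forall w s, `|w| <= 1 -> `|s| <= r ->
    `|p.[w%:P].[s]| <= K.
Proof.
move=> r0; elim/poly_ind: p => [|p c [K K0 hp]].
  by exists 0 => // w s _ _; rewrite !horner0 normr0.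
have [L L0 hc] : exists2 L : C, 0 <= L & forall s, `|s| <= r -> `|c.[s]| <= L.
  elim/poly_ind: c => [|c d [L L0 hc]].
    by exists 0 => // s _; rewrite !horner0 normr0.
  exists (L * r + `|d|); first by rewrite addr_ge0 ?mulr_ge0.
  move=> s sr; rewrite !hornerE (le_trans (ler_normD _ _)) // lerD2r normrM.
  by rewrite ler_pM // hc.
exists (K + L); first by rewrite addr_ge0.
move=> w s w1 sr; rewrite !hornerE (le_trans (ler_normD _ _)) //.
apply: lerD; last exact: hc.
by rewrite normrM (le_trans _ (hp w s w1 sr)) // ler_piMr.
Qed.

Lemma prim_root_exists N : (0 < N)%N -> exists z : C, N.-primitive_root z.
Proof.
move=> N0; have [rs rsE] := closed_field_poly_normal ('X^N - 1 : {poly C}).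
rewrite (monicP (monic_Xn_sub_1 _ N0)) scale1r in rsE.
suff /hasP[z _ zN] : has N.-primitive_root rs by exists z.
apply: (has_prim_root N0).
- by apply/allP => x xr; rewrite /root_of_unity rsE root_prod_XsubC.
- have : separable_poly ('X^N - 1 : {poly C}).
    by apply: separable_Xn_sub_1; rewrite pnatr_eq0 -lt0n.
  by rewrite rsE separable_prod_XsubC.
- by rewrite -ltnS -(size_prod_XsubC rs id) -rsE size_Xn_sub_1.
Qed.

Definition unity_root (N : nat) : C := xget 1 [set z | N.-primitive_root z].

Lemma unity_rootP N : (0 < N)%N -> N.-primitive_root (unity_root N).
Proof.
move=> N0; rewrite /unity_root; case: xgetP => [z _ //|h].
by have [z zN] := prim_root_exists N0; have := h z; rewrite /= zN.
Qed.

Lemma unity_root_norm N k : `|unity_root N ^+ k| = 1.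
Proof.
rewrite normrX; suff -> : `|unity_root N| = 1 by rewrite expr1n.
have [->|N0] := posnP N.
  rewrite /unity_root; case: xgetP => [z _ zN|_]; last by rewrite normr1.
  by have := prim_order_gt0 zN.
apply/eqP; rewrite -(@pexpr_eq1 _ _ N) // -normrX.
by rewrite (prim_expr_order (unity_rootP N0)) normr1.
Qed.

Definition unity_avg (N : nat) (g : C -> R) : R :=
  N%:R^-1 * \sum_(k < N) g (unity_root N ^+ k).

Definition has_mean (g : C -> R) (c : R) : Prop :=
  exists N0, forall N, (N0 <= N)%N -> unity_avg N g = c.

(** The averages over the N-th roots of unity of a Laurent polynomial are
    eventually constant; the mean is that constant. *)
Definition mean (g : C -> R) : R := xget 0 [set c | has_mean g c].

Lemma has_meanE g c : has_mean g c -> mean g = c.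
Proof.
move=> gc; rewrite /mean; case: xgetP => [d _ gd|h]; last by have := h c.
have [N0 h] := gc; have [N1 h1] := gd.
by rewrite -(h1 (maxn N0 N1)) ?leq_maxr // h ?leq_maxl.
Qed.

Lemma eq_unity_avg N g g' : (forall w, `|w| = 1 -> g w = g' w) -> unity_avg N g = unity_avg N g'.
Proof.
move=> gg; congr (_ * _); apply: eq_bigr => k _; apply: gg.
exact: unity_root_norm.
Qed.

Lemma eq_mean g g' : (forall w, `|w| = 1 -> g w = g' w) -> mean g = mean g'.
Proof.
move=> gg; congr xget; apply/funext => c; apply/propext; split=> -[N h];
  by exists N => M NM; rewrite -(h M NM); apply: eq_unity_avg => w /gg.
Qed.

Lemma eq_has_mean g g' c : (forall w, `|w| = 1 -> g w = g' w) ->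
  has_mean g c -> has_mean g' c.
Proof.
by move=> gg [N h]; exists N => M NM; rewrite -(h M NM); apply: eq_unity_avg => w /gg.
Qed.

Lemma has_meanD g g' c c' : has_mean g c -> has_mean g' c' ->
  has_mean (fun w => g w + g' w) (c + c').
Proof.
move=> [N h] [N' h']; exists (maxn N N') => M; rewrite geq_max => /andP[NM NM'].
by rewrite -(h M) // -(h' M) // /unity_avg big_split mulrDr.
Qed.

Lemma has_meanZ g c a : has_mean g c -> has_mean (fun w => a * g w) (a * c).
Proof.
move=> [N h]; exists N => M NM.
by rewrite -(h M) // /unity_avg -mulr_sumr mulrCA.
Qed.

Lemma has_mean_le g g' c c' : (forall w, `|w| = 1 -> g w <= g' w) ->
  has_mean g c -> has_mean g' c' -> c <= c'.
Proof.
move=> gg [N h] [N' h'].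
rewrite -(h (maxn N N')) ?leq_maxl // -(h' (maxn N N')) ?leq_maxr // /unity_avg.
rewrite ler_wpM2l ?invr_ge0 ?ler0n //; apply: ler_sum => k _; apply: gg.
exact: unity_root_norm.
Qed.

Lemma has_mean_ge0 g c : (forall w, `|w| = 1 -> 0 <= g w) -> has_mean g c -> 0 <= c.
Proof.
move=> g0; apply: (@has_mean_le (fun=> 0)) => //.
by exists 0%N => N _; rewrite /unity_avg big1 ?mulr0.
Qed.

Lemma sum_unity_root N z i j : N.-primitive_root z -> (i < N)%N -> (j < N)%N ->
  \sum_(k < N) (z ^+ k) ^+ i * ((z ^+ k) ^+ j)^-1 = (if i == j then N%:R else 0 : C).
Proof.
move=> zN iN jN.
have z0 : z != 0 by rewrite (prim_root_eq0 zN) -lt0n (leq_ltn_trans _ iN).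
pose x := z ^+ i / z ^+ j.
rewrite (eq_bigr (fun k : 'I_N => x ^+ k)); last first.
  by move=> k _; rewrite /x expr_div_n -!exprM [(k * i)%N]mulnC [(k * j)%N]mulnC.
have xE : (x == 1) = (i == j).
  rewrite /x -(inj_eq (mulIf (expf_neq0 j z0))) mulfVK ?expf_neq0 // mul1r.
  by rewrite (eq_prim_root_expr zN) /eqn !modn_small.
rewrite -xE; have [->|x1] := eqVneq x 1.
  by rewrite (eq_bigr (fun=> 1)) ?sumr_const ?card_ord // => k _; rewrite expr1n.
have := subrX1 x N; rewrite /x expr_div_n -!exprM ![(_ * N)%N]mulnC !exprM.
rewrite (prim_expr_order zN) !expr1n divr1 subrr -/x => /esym/eqP.
by rewrite mulf_eq0 subr_eq0 (negbTE x1) => /eqP.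
Qed.

(** g is the Laurent polynomial w^-J P(w), whose mean is its constant term. *)
Lemma has_mean_coef (g : C -> C) (J : nat) (P : {poly C}) :
  (forall w, `|w| = 1 -> w ^+ J * g w = P.[w]) ->
  has_mean (fun w => complex.Re (g w)) (complex.Re P`_J).
Proof.
move=> gP; exists (maxn J (size P)).+1 => N; rewrite gtn_max => /andP[JN PN].
have N0 : (0 < N)%N by exact: leq_ltn_trans JN.
have zN := unity_rootP N0; set z := unity_root N in zN *.
have N0' : (N%:R : R) != 0 by rewrite pnatr_eq0 -lt0n.
rewrite /unity_avg -raddf_sum /= -/z.
suff -> : \sum_(k < N) g (z ^+ k) = N%:R * P`_J.
  have -> : complex.Re (N%:R * P`_J) = N%:R * complex.Re P`_J.
    by rewrite !mulr_natl raddfMn.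
  by rewrite mulKf.
have zk0 k : z ^+ k != 0.
  by rewrite -normr_eq0 unity_root_norm oner_neq0.
transitivity (\sum_(k < N) \sum_(i < size P)
    P`_i * ((z ^+ k) ^+ i * ((z ^+ k) ^+ J)^-1)).
  apply: eq_bigr => k _.
  rewrite -[g _](mulKf (expf_neq0 J (zk0 k))) gP ?unity_root_norm //.
  rewrite horner_coef mulrC mulr_suml; apply: eq_bigr => i _; by rewrite mulrA.
rewrite exchange_big /=.
transitivity (\sum_(i < size P) if (i : nat) == J then N%:R * P`_i else 0).
  apply: eq_bigr => i _; rewrite -mulr_sumr (sum_unity_root zN) //; last first.
    by rewrite (leq_trans (ltn_ord i)) // ltnW.
  by case: ifP => _; rewrite ?mulr0 // mulrC.
rewrite -big_mkcond /=; case: (ltnP J (size P)) => JP.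
  by rewrite (big_pred1 (Ordinal JP)) // => i; rewrite /= -val_eqE.
rewrite big_pred0 ?nth_default ?mulr0 // => i.
by apply/negbTE; rewrite neq_ltn (leq_trans (ltn_ord i)).
Qed.

End Circle.

(** * The form carried by a real plane curve *)

Section ComplexFacts.
Variable R : realType.
Local Notation C := R[i].
Implicit Types (x y : C) (c : R).

Lemma ReZ c x : complex.Re (c%:C%C * x) = c * complex.Re x.
Proof. by case: x => a b /=; rewrite mul0r subr0. Qed.

Lemma ReD x y : complex.Re (x + y) = complex.Re x + complex.Re y.
Proof. by case: x; case: y. Qed.

Lemma ReJ x : complex.Re x^* = complex.Re x.
Proof. by case: x. Qed.

Lemma mulJ_Re x : x^* * x = (complex.Re (x^* * x))%:C%C.
Proof. by case: x => a b; apply/eqP; rewrite eq_complex /= eqxx; apply/eqP; ring. Qed.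

Lemma ReJM_ge0 x : 0 <= complex.Re (x^* * x).
Proof. by case: x => a b /=; nra. Qed.

Lemma normr_Re_sqr x : (complex.Re (x^* * x))%:C%C = `|x| ^+ 2.
Proof. by rewrite -mulJ_Re normCK mulrC. Qed.

Lemma Re_le_norm x c : `|x| <= c%:C%C -> complex.Re x <= c.
Proof.
move=> xc; rewrite -lecR; apply: le_trans xc.
by apply: le_trans (normc_ge_Re x); rewrite lecR ler_norm.
Qed.

Lemma sqr_norm_unit x : `|x| = 1 -> x^* * x = 1.
Proof. by move=> x1; rewrite mulrC unit_conjM. Qed.

End ComplexFacts.

(** A fixed diagonal of an N x N array has N entries up to an error independent
    of N. *)
Lemma count_diagonal (R : realDomainType) (N k J : nat) :
  `|\sum_(j < N) \sum_(l < N) (l + k == J + j)%N%:R - N%:R : R| <= (J + k)%:R.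
Proof.
have inner (j : 'I_N) : \sum_(l < N) (l + k == J + j)%N%:R
    = ((k <= J + j) && (J + j - k < N))%N%:R :> R.
  have [kj|kj] := leqP k (J + j); last first.
    rewrite big1 // => l _; rewrite gtn_eqF //.
    by rewrite (leq_trans kj) // leq_addl.
  have eqE l : (l + k == J + j)%N = (l == J + j - k)%N.
    by rewrite -{1}(subnK kj) eqn_add2r.
  case: (ltnP (J + j - k) N) => h /=.
    rewrite (bigD1 (Ordinal h)) //= eqE eqxx big1 ?addr0 // => l.
    by rewrite eqE -val_eqE /= => /negbTE ->.
  by rewrite big1 // => l _; rewrite eqE ltn_eqF // (leq_trans (ltn_ord l)).
have below M m : (\sum_(j < M) (j < m)%N <= m)%N.
  suff : (\sum_(j < M) (j < m)%N <= minn M m)%N.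
    by move/leq_trans; apply; exact: geq_minr.
  elim: M => [|M IH]; first by rewrite big_ord0.
  rewrite big_ord_recr /=; apply: (leq_trans (leq_add IH (leqnn _))).
  by case: (ltnP M m) => /= h; lia.
have above : (\sum_(j < N) (N <= J + j)%N <= J)%N.
  rewrite (reindex_inj rev_ord_inj) /=.
  apply: leq_trans (below N J); apply: leq_sum => j _.
  by have := ltn_ord j; case: (leqP N) => //= h'; case: ltnP => //=; lia.
have -> : N%:R = \sum_(j < N) 1 :> R by rewrite sumr_const card_ord.
rewrite -sumrB (le_trans (ler_norm_sum _ _ _)) //.
apply: (@le_trans _ _ (\sum_(j < N) ((N <= J + j)%N + (j < k)%N)%:R)); last first.
  rewrite -natr_sum ler_nat big_split /=.
  exact: (leq_add above (below N k)).
apply: ler_sum => j _; rewrite inner.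
case: (leqP k (J + j)) => h1 /=; last first.
  rewrite sub0r normrN normr1 ler1n addn_gt0 !lt0b; apply/orP; right.
  by lia.
case: (ltnP (J + j - k) N) => h2 /=; first by rewrite subrr normr0 ler0n.
rewrite sub0r normrN normr1 ler1n addn_gt0 !lt0b; apply/orP; left.
by lia.
Qed.

(** The ring A as a module over R by restriction of scalars along f. *)
Definition realified (R A : nzRingType) (f : {rmorphism R -> A}) : Type := A.

Section Realified.
Variables (R A : nzRingType) (f : {rmorphism R -> A}).
HB.instance Definition _ := GRing.Zmodule.on (realified f).

Definition realified_scale (c : R) (x : realified f) : realified f :=
  f c * (x : A).

Fact realified_scaleA a b x :
  realified_scale a (realified_scale b x) = realified_scale (a * b) x.
Proof. by rewrite /realified_scale rmorphM mulrA. Qed.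
Fact realified_scale1 : left_id 1 realified_scale.
Proof. by move=> x; rewrite /realified_scale rmorph1 mul1r. Qed.
Fact realified_scaleDr : right_distributive realified_scale +%R.
Proof. by move=> c x y; rewrite /realified_scale mulrDr. Qed.
Fact realified_scaleDl x : {morph realified_scale^~ x : a b / a + b}.
Proof. by move=> a b; rewrite /realified_scale rmorphD mulrDl. Qed.

HB.instance Definition _ := GRing.Zmodule_isLmodule.Build R (realified f)
  realified_scaleA realified_scale1 realified_scaleDr realified_scaleDl.

End Realified.

Section Spaces.
Variable R : realType.
Local Notation C := R[i].

Definition base_space := realified (polyC \o real_complex R).
Definition curve_space := realified (polyC \o (polyC \o real_complex R)).

Definition const_coef (p : curve_space) : base_space := (p : {poly {poly C}})`_0.

Fact const_coef_linear : linear const_coef.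
Proof.
move=> c p q; rewrite /const_coef coefD; congr (_ + _).
by rewrite coefCM.
Qed.
HB.instance Definition _ := GRing.isLinear.Build R curve_space base_space _
  const_coef const_coef_linear.

(** [mul_w], [mul_s] and [base_mul_s] are rotated by conj w0 and conj z0, so that
    the point of the circle under study is always at 1 and the values of
    conj z0 * s over it are real. *)
Definition mul_w (w0 : C) (p : curve_space) : curve_space :=
  (w0^*)%:P%:P * 'X * (p : {poly {poly C}}).
Definition mul_s (z0 : C) (p : curve_space) : curve_space :=
  ((z0^*)%:P * 'X)%:P * (p : {poly {poly C}}).
Definition base_mul_s (z0 : C) (u : base_space) : base_space :=
  (z0^*)%:P * 'X * (u : {poly C}).

Fact mul_w_additive w0 : zmod_morphism (mul_w w0).
Proof. by move=> p q; rewrite /mul_w mulrBr. Qed.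
Fact mul_s_additive z0 : zmod_morphism (mul_s z0).
Proof. by move=> p q; rewrite /mul_s mulrBr. Qed.
Fact base_mul_s_additive z0 : zmod_morphism (base_mul_s z0).
Proof. by move=> p q; rewrite /base_mul_s mulrBr. Qed.
HB.instance Definition _ w0 := GRing.isZmodMorphism.Build curve_space curve_space
  (mul_w w0) (mul_w_additive w0).
HB.instance Definition _ z0 := GRing.isZmodMorphism.Build curve_space curve_space
  (mul_s z0) (mul_s_additive z0).
HB.instance Definition _ z0 := GRing.isZmodMorphism.Build base_space base_space
  (base_mul_s z0) (base_mul_s_additive z0).

Definition ev (p : curve_space) (w s : C) : C := (p : {poly {poly C}}).[w%:P].[s].

Lemma evD p q w s : ev (p + q) w s = ev p w s + ev q w s.
Proof. by rewrite /ev !hornerD. Qed.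
Lemma evB p q w s : ev (p - q) w s = ev p w s - ev q w s.
Proof. by rewrite /ev !hornerD !hornerN. Qed.
Lemma evZ c p w s : ev (c *: p) w s = c%:C%C * ev p w s.
Proof. by rewrite /ev !hornerM !hornerC. Qed.
Lemma ev_mul_w w0 p w s : ev (mul_w w0 p) w s = w0^* * w * ev p w s.
Proof. by rewrite /ev /mul_w !hornerE. Qed.
Lemma ev_mul_s z0 p w s : ev (mul_s z0 p) w s = z0^* * s * ev p w s.
Proof. by rewrite /ev /mul_s !hornerE. Qed.
Lemma ev_iter_mul_w w0 j p w s :
  ev (iter j (mul_w w0) p) w s = (w0^* * w) ^+ j * ev p w s.
Proof. by elim: j => [|j IH]; rewrite ?mul1r //= ev_mul_w IH exprS mulrA. Qed.

End Spaces.

Section Curve.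
Variables (R : realType) (F : {poly {poly R[i]}}).
Local Notation C := R[i].
Local Notation P := (curve_space R).
Hypothesis Fm : F \is monic.

Definition fibre (w : C) : seq C :=
  sval (closed_field_poly_normal (map_poly (horner_eval w) F)).

Lemma fibreE w :
  map_poly (horner_eval w) F = \prod_(x <- fibre w) ('X - x%:P).
Proof.
rewrite /fibre; case: closed_field_poly_normal => rs /= E.
by rewrite {1}E (monicP (monic_map _ Fm)) scale1r.
Qed.

Lemma size_fibre w : size F = (size (fibre w)).+1.
Proof.
rewrite -(size_prod_XsubC (fibre w) id) -fibreE size_map_poly_id0 //.
by rewrite (monicP Fm) rmorph1 oner_neq0.
Qed.

Hypothesis curve : forall w s : C, `|w| = 1 -> s \in fibre w -> s = w * s^*.

Definition fibre_form (p q : P) (w : C) : C :=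
  \sum_(s <- fibre w) (ev p w s)^* * ev q w s.

Definition curve_form (p q : P) : R :=
  mean (fun w => complex.Re (fibre_form p q w)).

(** The exponent J depends on p only; this is the origin of [shift_band]. *)
Lemma fibre_form_poly (p : P) : exists J : nat, forall q, exists A : {poly C},
  forall w, `|w| = 1 -> w ^+ J * fibre_form p q w = A.[w].
Proof.
have [J [p' hp']] := conj_bivariate p.
exists J => q.
have [A hA] := fibre_sum_poly (swapXY (p' * (q : {poly {poly C}}))) Fm.
exists A => w w1; rewrite -(hA w _ (fibreE w)) /fibre_form mulr_sumr.
rewrite !big_seq; apply: eq_bigr => s sw.
rewrite -horner_polyC mulrA /ev hp' //; last exact: curve.
by rewrite !hornerM.
Qed.

Lemma curve_formP p q :
  has_mean (fun w => complex.Re (fibre_form p q w)) (curve_form p q).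
Proof.
have [J /(_ q) [A hA]] := fibre_form_poly p.
by have h := has_mean_coef hA; rewrite /curve_form (has_meanE h).
Qed.

Lemma curve_form_ext p q p' q' :
  (forall w s, `|w| = 1 -> s \in fibre w ->
    complex.Re ((ev p w s)^* * ev q w s) = complex.Re ((ev p' w s)^* * ev q' w s)) ->
  curve_form p q = curve_form p' q'.
Proof.
move=> h; apply: eq_mean => w w1; rewrite /fibre_form !raddf_sum !big_seq.
by apply: eq_bigr => s sw; exact: h.
Qed.

Lemma curve_form_si : semi_inner curve_form.
Proof.
split.
- by move=> p q; apply: curve_form_ext => w s _ _; rewrite -ReJ rmorphM /= conjCK mulrC.
- move=> p q r; apply: has_meanE.
  apply: eq_has_mean (has_meanD (curve_formP p q) (curve_formP p r)) => w _.
  rewrite -raddfD /fibre_form -big_split /=; congr complex.Re.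
  by apply: eq_bigr => s _; rewrite evD mulrDr.
- move=> c p q; apply: has_meanE.
  apply: eq_has_mean (has_meanZ c (curve_formP p q)) => w _.
  rewrite -ReZ /fibre_form mulr_sumr; congr complex.Re.
  by apply: eq_bigr => s _; rewrite evZ mulrCA.
- move=> p; apply: has_mean_ge0 (curve_formP p p) => w _ /=.
  rewrite /fibre_form raddf_sum; apply: sumr_ge0 => s _.
  exact: ReJM_ge0.
Qed.

Variable w0 : C.
Hypothesis w01 : `|w0| = 1.

Lemma w0J : w0 * w0^* = 1. Proof. exact: unit_conjM. Qed.

Lemma curve_form_iter p : exists (J : nat), forall q, exists A : {poly C},
  (forall w, `|w| = 1 -> w ^+ J * fibre_form p q w = A.[w]) /\
  forall j l, curve_form (iter j (mul_w w0) p) (iter l (mul_w w0) q)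
   = complex.Re ((w0 ^+ j * w0^* ^+ l) * ('X^l * A)`_(J + j)).
Proof.
have [J hJ] := fibre_form_poly p.
exists J => q; have [A hA] := hJ q; exists A; split=> // j l.
apply: has_meanE.
rewrite -coefCM; apply: has_mean_coef => w w1.
have -> : fibre_form (iter j (mul_w w0) p) (iter l (mul_w w0) q) w
   = (w0 ^+ j * w0^* ^+ l) * (w^* ^+ j * w ^+ l) * fibre_form p q w.
  rewrite /fibre_form mulr_sumr; apply: eq_bigr => s _.
  rewrite !ev_iter_mul_w rmorphM rmorphXn rmorphM /= conjCK !exprMn; ring.
rewrite !hornerM hornerC hornerXn -hA // exprD.
have wj : w ^+ j * w^* ^+ j = 1 by rewrite -exprMn unit_conjM // expr1n.
rewrite -[RHS]mulr1 -wj; ring.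
Qed.

Lemma curve_shift : shift_system curve_form (@const_coef R) (mul_w w0).
Proof.
split.
- exact: curve_form_si.
- move=> p q; apply: curve_form_ext => w s w1 _; congr complex.Re.
  rewrite !ev_mul_w !rmorphM /= conjCK.
  transitivity ((w0 * w0^*) * (w * w^*) * ((ev p w s)^* * ev q w s)); first by ring.
  by rewrite w0J unit_conjM // !mul1r.
- by move=> u; exists ((u : {poly C})%:P); rewrite /= /const_coef coefC.
- move=> p; rewrite /= /const_coef /mul_w -mulrA coefCM coefXM /=.
  by rewrite mulr0.
- move=> p; rewrite /= /const_coef => p0.
  have [r rE] : exists r : {poly {poly C}}, (p : {poly {poly C}}) = r * ('X - 0%:P).
    by apply/factor_theorem; rewrite rootE horner_coef0 p0.
  exists ((w0%:P%:P : {poly {poly C}}) * r); rewrite /mul_w rE subr0.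
  transitivity (((w0 * w0^*)%:P%:P * 'X) * r).
    by rewrite w0J mul1r mulrC.
  by rewrite !polyCM; ring.
- move=> p; have [J hJ] := curve_form_iter p.
  exists J.+1 => q; have [A [_ /(_ 0%N J.+1)]] := hJ q.
  by rewrite /= => ->; rewrite addn0 coefXnM ltnSn mulr0.
Qed.

(** Cauchy's bound, uniform because the coefficients are bounded on the circle. *)
Lemma fibre_bounded : exists2 r : R, 0 <= r &
  forall w s : C, `|w| = 1 -> s \in fibre w -> `|s| <= r%:C%C.
Proof.
pose K : C := \sum_(i < (size F).-1) \sum_(j < size F`_i) `|F`_i`_j|.
have K0 : 0 <= K by apply: sumr_ge0 => i _; apply: sumr_ge0.
have KE : K = (complex.Re K)%:C%C by rewrite RRe_real // ger0_real.
exists (1 + complex.Re K).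
  by rewrite addr_ge0 ?ler01 // -lecR -KE.
move=> w s w1 sw; rewrite rmorphD /= -KE rmorph1.
have [s1|s1] : `|s| <= 1 \/ 1 <= `|s|.
- by apply/orP; apply: real_leVge; rewrite ?normr_real ?real1.
- by rewrite (le_trans s1) // lerDl.
have : (map_poly (horner_eval w) F).[s] = 0.
  by apply/eqP; rewrite -[_ == 0]/(root _ s) fibreE root_prod_XsubC.
have sF := size_fibre w.
have n0 : (0 < (size F).-1)%N.
  by rewrite sF /=; case: (fibre w) sw.
have sFw : size (map_poly (horner_eval w) F) = (size F).-1.+1.
  by rewrite fibreE size_prod_XsubC sF.
rewrite horner_coef sFw big_ord_recr /=.
have -> : (map_poly (horner_eval w) F)`_(size F).-1 = 1.
  have /monicP := monic_map (horner_eval w) Fm.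
  by rewrite lead_coefE sFw.
rewrite mul1r addrC => /eqP; rewrite addr_eq0 => /eqP sE.
have {sE} h : `|s| ^+ (size F).-1 <= K * `|s| ^+ (size F).-2.
  rewrite -normrX sE normrN (le_trans (ler_norm_sum _ _ _)) // /K mulr_suml.
  apply: ler_sum => i _; rewrite normrM ler_pM //.
    rewrite coef_map /= /horner_eval horner_coef (le_trans (ler_norm_sum _ _ _)) //.
    by apply: ler_sum => j _; rewrite normrM normrX w1 expr1n mulr1.
  by rewrite normrX ler_weXn2l // -ltnS prednK // ltn_ord.
rewrite -(prednK n0) exprS ler_pM2r ?exprn_gt0 ?(lt_le_trans ltr01) // in h.
by rewrite (le_trans h) // lerDr.
Qed.

Variable z0 : C.
Hypothesis z0w : z0 ^+ 2 = w0.

Lemma z01 : `|z0| = 1.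
Proof. by apply/eqP; rewrite -(@pexpr_eq1 _ _ 2) // -normrX z0w w01. Qed.

Lemma z0J : z0^* * z0 = 1. Proof. exact/sqr_norm_unit/z01. Qed.

Lemma curve_multiplier : exists rho, multiplier curve_form (@const_coef R)
  (mul_w w0) (mul_s z0) (base_mul_s z0) rho.
Proof.
have [rho rho0 hrho] := fibre_bounded; exists rho; split=> //.
- by move=> p; rewrite /= /const_coef /mul_s /base_mul_s coefCM.
- by move=> p; rewrite /= /mul_w /mul_s mulrCA.
- move=> p q; apply: curve_form_ext => w s w1 sw; congr complex.Re.
  rewrite ev_mul_w !ev_mul_s !rmorphM /= !conjCK -z0w.
  set X := (ev p w s)^*; set Y := ev q w s.
  transitivity (z0 ^+ 2 * w^* * z0^* * s * (X * Y)); first by ring.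
  rewrite [in LHS](curve w1 sw).
  transitivity ((z0^* * z0) * (w * w^*) * (z0 * s^* * X * Y)); first by ring.
  by rewrite z0J unit_conjM // !mul1r.
- move=> p.
  rewrite -(@ler_pXn2r _ 2) ?nnegrE ?mulr_ge0 ?seminorm_ge0 //.
  rewrite exprMn !(seminorm_sqr curve_form_si).
  apply: has_mean_le (curve_formP _ _) (has_meanZ _ (curve_formP p p)) => w w1.
  rewrite -ReZ /fibre_form mulr_sumr !raddf_sum !big_seq /=.
  apply: ler_sum => s sw; rewrite !ReZ ev_mul_s rmorphM mulrACA.
  rewrite (mulJ_Re (z0^* * s)) ReZ ler_wpM2r ?ReJM_ge0 //.
  rewrite -lecR normr_Re_sqr rmorphXn /= normrM norm_conjC z01 mul1r.
  by rewrite ler_pXn2r ?nnegrE ?normr_ge0 ?ler0c //; exact: (hrho w).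
Qed.

(** Quantitative continuity of the roots at w0.  If s lies over w and conj z0 * s
    has real part beyond tau + eta / 2, then s is at distance at least eta / 2
    from all the roots over w0, so |F(s, w0)| >= (eta / 2)^n, while F(s, w) = 0
    gives |F(s, w0)| <= k |w - w0|. *)
Lemma fibre_gap tau eta : (forall s, s \in fibre w0 -> complex.Re (z0^* * s) <= tau) ->
  0 < eta -> exists2 d : R, 0 < d & forall w s : C, `|w| = 1 -> s \in fibre w ->
    2 * tau + eta < 2 * complex.Re (z0^* * s) ->
    d <= complex.Re ((1 - w0^* * w)^* * (1 - w0^* * w)).
Proof.
move=> htau eta0; have [rho rho0 hrho] := fibre_bounded.
have evF w s : (swapXY F).[w%:P].[s] = \prod_(x <- fibre w) (s - x).
  rewrite horner_polyC swapXYK fibreE horner_prod.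
  by apply: eq_bigr => x _; rewrite hornerXsubC.
have [H HE] : exists H, swapXY F - ((swapXY F).[w0%:P])%:P = H * ('X - w0%:P%:P).
  by apply/factor_theorem; rewrite rootE !hornerE subrr.
have rho0' : (0 : C) <= rho%:C%C by rewrite ler0c.
have [K K0 hK] := bounded_bivariate H rho0'.
have KE : K = (complex.Re K)%:C%C by rewrite RRe_real // ger0_real.
pose k := complex.Re K + 1.
have k0 : 0 < k by rewrite ltr_wpDl // -lecR -KE.
pose d := (eta / 2) ^+ (size F).-1 / k.
have eta20 : 0 < eta / 2 by rewrite divr_gt0.
have d0 : 0 < d by rewrite divr_gt0 // exprn_gt0.
exists (d ^+ 2); first by rewrite exprn_gt0.
move=> w s w1 sw hs.
have ws0 : (swapXY F).[w%:P].[s] = 0.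
  apply/eqP; rewrite evF prodf_seq_eq0; apply/hasP; exists s => //=.
  by rewrite subrr.
have low : ((eta / 2) ^+ (size F).-1)%:C%C <= `|(swapXY F).[w0%:P].[s]|.
  rewrite evF normr_prod (size_fibre w0) rmorphXn /=.
  rewrite -iter_mulr_1 -[size _]count_predT -big_const_seq.
  rewrite !big_seq; apply: ler_prod => x xw; rewrite ler0c ltW //=.
  have : complex.Re (z0^* * (s - x)) <= complex.Re `|s - x|.
    apply: Re_le_norm; rewrite normrM norm_conjC z01 mul1r.
    by rewrite RRe_real // normr_real.
  rewrite mulrBr raddfB /= => h.
  rewrite -[X in _ <= X](RRe_real (normr_real _)) lecR (le_trans _ h) //.
  have := htau x xw; lra.
have up : `|(swapXY F).[w0%:P].[s]| <= k%:C%C * `|1 - w0^* * w|.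
  have := congr1 (fun u => u.[w%:P].[s]) HE.
  rewrite !(hornerE, hornerD, hornerN, hornerM, hornerC) /= ws0 sub0r => E.
  rewrite -normrN E normrM ler_pM //.
    apply: (le_trans (hK _ _ _ _)); [by rewrite w1 | exact: (hrho w)|].
    by rewrite KE lecR lerDl.
  have -> : 1 - w0^* * w = w0^* * (w0 - w).
    by rewrite mulrBr (sqr_norm_unit w01).
  by rewrite normrM norm_conjC w01 mul1r distrC.
rewrite -lecR normr_Re_sqr rmorphXn /=.
rewrite ler_pXn2r ?nnegrE ?normr_ge0 ?ler0c ?(ltW d0) //.
have k0' : (0 : C) < k%:C%C by rewrite ltcR.
rewrite -(ler_pM2l k0') -rmorphM /= /d mulrCA divff ?gt_eqF // mulr1.
exact: le_trans low up.
Qed.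

Lemma peak_form_ge0 tau eta :
  (forall s, s \in fibre w0 -> complex.Re (z0^* * s) <= tau) -> 0 < eta ->
  exists c, forall q,
    0 <= peak_form curve_form (mul_w w0) (mul_s z0) (2 * tau + eta) c q.
Proof.
move=> htau eta0; have [d d0 hd] := fibre_gap htau eta0.
have [rho rho0 hrho] := fibre_bounded.
pose a := 2 * rho + `|2 * tau + eta|.
exists (a / d) => q; rewrite /peak_form.
set t := 2 * tau + eta in hd a *; set c := a / d.
have h1 := has_meanZ t (curve_formP q q).
have h2 := has_meanZ (- 2) (curve_formP q (mul_s z0 q)).
have h3 := has_meanZ c (curve_formP (q - mul_w w0 q) (q - mul_w w0 q)).
have := has_meanD (has_meanD h1 h2) h3; rewrite mulNr => h.
apply: has_mean_ge0 h => w w1 /=; rewrite /fibre_form -!ReZ -!ReD !mulr_sumr -!big_split /=.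
rewrite raddf_sum big_seq; apply: sumr_ge0 => s sw.
rewrite /= !ReD !ReZ evB ev_mul_w ev_mul_s.
set D := complex.Re ((1 - w0^* * w)^* * (1 - w0^* * w)).
set n := complex.Re ((ev q w s)^* * ev q w s).
have n0 : 0 <= n by exact: ReJM_ge0.
have -> : complex.Re ((ev q w s)^* * (z0^* * s * ev q w s))
    = n * complex.Re (z0^* * s) by rewrite mulrCA mulJ_Re mulrC ReZ.
have -> : complex.Re ((ev q w s - w0^* * w * ev q w s)^*
    * (ev q w s - w0^* * w * ev q w s)) = n * D.
  rewrite -[X in X - _]mul1r -mulrBl rmorphM /= mulrACA [X in _ * X]mulJ_Re.
  by rewrite mulrC ReZ.
have D0 : 0 <= D by exact: ReJM_ge0.
have a0 : 0 <= a by rewrite addr_ge0 ?mulr_ge0.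
have c0 : 0 <= c by rewrite divr_ge0 // ltW.
suff : 0 <= t - 2 * complex.Re (z0^* * s) + c * D.
  by move=> /(mulr_ge0 n0); congr (0 <= _); ring.
have [small|big] := leP (2 * complex.Re (z0^* * s)) t.
  by rewrite addr_ge0 ?subr_ge0 // mulr_ge0.
have srho : complex.Re (z0^* * s) <= rho.
  apply: Re_le_norm; rewrite normrM norm_conjC z01 mul1r; exact: (hrho w s w1 sw).
have : a <= c * D.
  rewrite /c -mulrA ler_peMr // ler_pdivlMl // mulr1; exact: (hd w s w1 sw big).
by rewrite /a; have := ler_norm (- t); rewrite normrN; lra.
Qed.

(** The Fejer kernel: only the pairs (j, l) on boundedly many diagonals
    contribute, and each such diagonal has about N entries. *)
Lemma fejer_sum p q : exists K, forall N : nat,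
  `|\sum_(j < N) \sum_(l < N)
       curve_form (iter j (mul_w w0) p) (iter l (mul_w w0) q)
     - N%:R * complex.Re (fibre_form p q w0)| <= K.
Proof.
have [J hJ] := curve_form_iter p; have [A [hA hb]] := hJ q.
pose v (k : nat) := complex.Re (w0 ^+ k * w0^* ^+ J * A`_k).
exists (\sum_(k < size A) `|v k| * (J + k)%:R) => N.
have w00 : w0 != 0 by rewrite -normr_eq0 w01 oner_neq0.
have unit_pow a : w0 ^+ a * w0^* ^+ a = 1 by rewrite -exprMn w0J expr1n.
have -> : complex.Re (fibre_form p q w0) = \sum_(k < size A) v k.
  have -> : fibre_form p q w0 = w0^* ^+ J * A.[w0].
    by rewrite -hA // mulrA [_ * w0 ^+ J]mulrC unit_pow mul1r.
  rewrite horner_coef mulr_sumr raddf_sum; apply: eq_bigr => k _.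
  by congr complex.Re; rewrite /=; ring.
have -> : \sum_(j < N) \sum_(l < N)
     curve_form (iter j (mul_w w0) p) (iter l (mul_w w0) q)
   = \sum_(k < size A) v k * \sum_(j < N) \sum_(l < N) (l + k == J + j)%N%:R.
  under [RHS]eq_bigr do rewrite mulr_sumr.
  rewrite [RHS]exchange_big; apply: eq_bigr => j _ /=.
  under [RHS]eq_bigr do rewrite mulr_sumr.
  rewrite [RHS]exchange_big; apply: eq_bigr => l _ /=.
  rewrite hb coefXnM; case: ltnP => lJ.
    rewrite mulr0 big1 // => k _; rewrite gtn_eqF ?mulr0 //.
    by rewrite (leq_trans lJ) // leq_addr.
  have eqE k : (l + k == J + j)%N = (k == J + j - l)%N.
    by rewrite -{1}(subnKC lJ) eqn_add2l.
  case: (ltnP (J + j - l) (size A)) => h; last first.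
    rewrite nth_default // mulr0 big1 // => k _.
    by rewrite eqE ltn_eqF ?mulr0 // (leq_trans (ltn_ord k)).
  rewrite (bigD1 (Ordinal h)) //= eqE eqxx mulr1 big1 ?addr0; last first.
    by move=> k; rewrite eqE -val_eqE /= => /negbTE ->; rewrite mulr0.
  rewrite /v; congr (complex.Re (_ * _)).
  rewrite -[LHS]mulr1 -(unit_pow J) mulrACA -exprD [(j + J)%N]addnC.
  rewrite -[in LHS](subnK lJ) exprD -mulrA; congr (_ * _).
  by rewrite mulrA unit_pow mul1r.
rewrite mulr_sumr -sumrB (le_trans (ler_norm_sum _ _ _)) //.
apply: ler_sum => k _; rewrite [N%:R * _]mulrC -mulrBr normrM ler_wpM2l //.
exact: count_diagonal.
Qed.

(** Apply the hypothesis to the sums a + W a + ... + W^(N-1) a, where a is a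
    polynomial in s.  Divided by N, the first two terms of [peak_form] tend to
    their fibre sum at w0, while q - W q = a - W^N a stays
    bounded.  Choosing a to vanish at the other points of the fibre isolates s0. *)
Lemma bound_of_peak_form tau :
  (forall eta, 0 < eta -> exists c, forall q,
    0 <= peak_form curve_form (mul_w w0) (mul_s z0) (2 * tau + eta) c q) ->
  forall s, s \in fibre w0 -> complex.Re (z0^* * s) <= tau.
Proof.
move=> hpeak s0 s0w.
have bP := curve_form_si; have sP := curve_shift.
have [rho mP] := curve_multiplier.
(* Repeated roots at s0 do no harm: a0 omits all the factors of s0. *)
pose a0 : {poly C} := \prod_(x <- fibre w0 | x != s0) ('X - x%:P).
pose a : P := a0%:P.
have eva s : ev a w0 s = a0.[s] by rewrite /ev hornerC.
pose m := complex.Re ((ev a w0 s0)^* * ev a w0 s0).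
have m0 : 0 < m.
  rewrite lt_def ReJM_ge0 andbT; apply/negP => /eqP mE.
  have := mulJ_Re (ev a w0 s0); rewrite -/m mE.
  move/eqP; rewrite mulf_eq0 conjC_eq0 orbb eva horner_prod prodf_seq_eq0.
  move=> /hasP[x _ /andP[xs]]; rewrite hornerXsubC subr_eq0 => /eqP sx.
  by rewrite sx eqxx in xs.
pose n := (count_mem s0 (fibre w0))%:R : R.
have n0 : 0 < n by rewrite ltr0n -has_count has_pred1.
have single (g : C -> R) : (forall s, s \in fibre w0 -> s != s0 -> g s = 0) ->
    \sum_(s <- fibre w0) g s = n * g s0.
  move=> hg; rewrite (bigID (pred1 s0)) /= [X in _ + X]big_seq_cond.
  rewrite [X in _ + X]big1 ?addr0; last by move=> s /andP[/hg h /h].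
  rewrite (eq_bigr (fun=> g s0)); last by move=> s /eqP ->.
  by rewrite big_const_seq iter_addr_0 mulr_natl.
have avanish s : s \in fibre w0 -> s != s0 -> ev a w0 s = 0.
  move=> sw ss; rewrite eva horner_prod; apply/eqP; rewrite prodf_seq_eq0.
  by apply/hasP; exists s => //; rewrite ss hornerXsubC subrr eqxx.
have haa : complex.Re (fibre_form a a w0) = n * m.
  by rewrite raddf_sum single // => s sw ss; rewrite avanish // mulr0.
have haS : complex.Re (fibre_form a (mul_s z0 a) w0)
    = n * (m * complex.Re (z0^* * s0)).
  rewrite raddf_sum single => [|s sw ss]; last first.
    by rewrite ev_mul_s avanish // !mulr0.
  congr (n * _); rewrite /= ev_mul_s mulrCA mulJ_Re.
  by rewrite [X in complex.Re X]mulrC ReZ.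
have [K1 hK1] := fejer_sum a a.
have [K2 hK2] := fejer_sum a (mul_s z0 a).
rewrite -subr_le0; apply: (@le0_of_le_small _ _ 0 (1 / 2)) => eta eta0 _.
have [c hc] := hpeak eta eta0; set t := 2 * tau + eta in hc *.
have : 0 <= (n * m) * (t - 2 * complex.Re (z0^* * s0)).
  apply: (@ge0_of_le_linear _ _ (`|t| * K1 + 2 * K2 + `|c| * (4 * curve_form a a))) => N.
  pose q := \sum_(j < N) iter j (mul_w w0) a.
  have h := hc q; rewrite /peak_form in h.
  have e1 : curve_form q q = \sum_(j < N) \sum_(l < N)
       curve_form (iter j (mul_w w0) a) (iter l (mul_w w0) a).
    by rewrite /q (si_suml bP); apply: eq_bigr => j _; rewrite (si_sumr bP).
  have e2 : curve_form q (mul_s z0 q) = \sum_(j < N) \sum_(l < N)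
       curve_form (iter j (mul_w w0) a) (iter l (mul_w w0) (mul_s z0 a)).
    rewrite /q raddf_sum (si_suml bP); apply: eq_bigr => j _.
    rewrite (si_sumr bP); apply: eq_bigr => l _.
    by rewrite -(iter_shift_mul mP).
  have e3 : q - mul_w w0 q = a - iter N (mul_w w0) a.
    rewrite /q raddf_sum /= -sumrB.
    elim: (N) => [|M IH]; first by rewrite big_ord0 subrr.
    by rewrite big_ord_recr /= IH addrA subrK.
  have h3 : curve_form (q - mul_w w0 q) (q - mul_w w0 q) <= 4 * curve_form a a.
    rewrite e3; set x := iter N _ a.
    have xx : curve_form x x = curve_form a a by exact: (iter_shift_iso sP).
    have := si_ge0 bP (a + x).
    rewrite !(siD bP) !(siDl bP) !(siNr bP) !(siNl bP) xx; lra.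
  have := hK1 N; have := hK2 N; rewrite haa haS -e1 -e2 => k2 k1.
  have k1' : t * (curve_form q q - N%:R * (n * m)) <= `|t| * K1.
    by apply: (le_trans (ler_norm _)); rewrite normrM ler_wpM2l.
  have k2' : - K2 <= curve_form q (mul_s z0 q) - N%:R * (n * (m * complex.Re (z0^* * s0))).
    by move: k2; rewrite ler_norml => /andP[].
  have k3 : c * curve_form (q - mul_w w0 q) (q - mul_w w0 q)
      <= `|c| * (4 * curve_form a a).
    apply: (@le_trans _ _ (`|c| * curve_form (q - mul_w w0 q) (q - mul_w w0 q))).
      by rewrite ler_wpM2r ?(si_ge0 bP) // ler_norm.
    by rewrite ler_wpM2l.
  move: h k1' k2' k3; set X := curve_form q q; set Y := curve_form q _.
  set Z := curve_form (q - _) _ => h k1' k2' k3.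
  have -> : N%:R * (n * m * (t - 2 * complex.Re (z0^* * s0)))
    = t * (N%:R * (n * m)) - 2 * (N%:R * (n * (m * complex.Re (z0^* * s0)))).
    by ring.
  lra.
rewrite pmulr_rge0 ?mulr_gt0 // /t; lra.
Qed.

Theorem fibre_le_iff_compression_le tau :
  (forall s, s \in fibre w0 -> complex.Re (z0^* * s) <= tau) <->
  compression_le curve_form (@const_coef R) (base_mul_s z0) tau.
Proof.
have [rho mP] := curve_multiplier.
rewrite (compression_le_iff_peak_form curve_shift mP); split.
  by move=> h eta eta0; exact: peak_form_ge0.
exact: bound_of_peak_form.
Qed.

End Curve.

(** * The matrix pencil *)

Section BaseSpace.
Variable R : realType.
Local Notation C := R[i].
Local Notation V := (base_space R).

Lemma base_mul_sE (z : C) (u : V) : base_mul_s z u =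
  complex.Re z *: base_mul_s 1 u + complex.Im z *: base_mul_s 'i%C u :> V.
Proof.
rewrite /base_mul_s /GRing.scale /= /realified_scale /= !mulrA -!mulrDl.
congr (_ * _ * _); rewrite -!polyCM -polyCD; congr (_%:P).
by case: z => a b; apply/eqP; rewrite eq_complex /=; apply/andP; split; apply/eqP; ring.
Qed.

Fact base_mul_s_linear (z : C) : linear (@base_mul_s R z).
Proof.
by move=> c u x; rewrite /base_mul_s mulrDr; congr (_ + _); rewrite mulrCA.
Qed.

End BaseSpace.

Section FiniteForm.
Variables (R : realType) (G : base_space R -> base_space R -> R).
Local Notation C := R[i].
Local Notation V := (base_space R).
Hypothesis Gsi : semi_inner G.

Lemma form_mul_s (z : C) (u x : V) : G x (base_mul_s z u) =
  complex.Re z * G x (base_mul_s 1 u)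
  + complex.Im z * G x (base_mul_s 'i%C u).
Proof.
rewrite (base_mul_sE z u).
move: (base_mul_s 1 u) (base_mul_s 'i%C u) => y y'.
by rewrite (siD Gsi) (siZ Gsi) (siZ Gsi _ x y').
Qed.

Variables (n : nat) (F0 : {poly C}).
Hypotheses (F0m : F0 \is monic) (sF0 : size F0 = n.+1).
Hypothesis Gnull : forall (g : {poly C}) (x : V), G (F0 * g) x = 0.

(** A basis over the reals of the complex polynomials of degree less than n. *)
Definition monomial (k : 'I_(n + n)) : V :=
  match fintype.split k with inl j => 'X^j | inr j => 'i%C%:P * 'X^j end.

Definition comb (v : 'rV[R]_(n + n)) : V := \sum_k v 0 k *: monomial k.

Lemma comb_surj (u : {poly C}) : (size u <= n)%N -> exists v, comb v = u.
Proof.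
move=> su.
exists (row_mx (\row_(j < n) complex.Re u`_j) (\row_(j < n) complex.Im u`_j)).
rewrite /comb big_split_ord /= [RHS](_ : _ = \poly_(j < n) u`_j); last first.
  by apply/polyP => j; rewrite coef_poly; case: ltnP => // /(leq_trans su) /leq_sizeP ->.
rewrite poly_def -big_split /=; apply: eq_bigr => j _.
rewrite -[in RHS]mul_polyC row_mxEl row_mxEr !mxE /monomial.
rewrite (unsplitK (inl j)) (unsplitK (inr j)) /=.
rewrite /GRing.scale /= /realified_scale /= mulrA -polyCM -mulrDl -polyCD.
congr (_%:P * _).
by rewrite [RHS]complexE mulrC [in RHS]mulrC; case: (u`_j) => a b; simpc.
Qed.

(** Division by F0, on whose multiples G vanishes. *)
Lemma comb_reduce (u : V) : exists v, G (comb v) (comb v) = G u u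
  /\ forall z, G (comb v) (base_mul_s z (comb v)) = G u (base_mul_s z u).
Proof.
have E := Pdiv.RingMonic.rdivp_eq F0m (u : {poly C}).
set q := Pdiv.CommonRing.rdivp _ _ in E.
set r := Pdiv.CommonRing.rmodp _ _ in E.
have sr : (size r <= n)%N.
  by rewrite -ltnS -sF0 Pdiv.CommonRing.ltn_rmodp monic_neq0.
have [v vr] := comb_surj sr; exists v; rewrite vr.
have uE : u = (F0 * q : V) + (r : V) by rewrite mulrC -E.
have null1 g x : G (F0 * g : V) x = 0 by exact: Gnull.
have null2 g x : G x (F0 * g : V) = 0.
  by rewrite (siC Gsi) null1.
split=> [|z].
  by rewrite uE (siD Gsi) !(siDl Gsi) !null1 null2 !add0r.
rewrite uE raddfD /= (siD Gsi) !(siDl Gsi) !null1.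
have -> : base_mul_s z (F0 * q : V) = (F0 * ((z^*)%:P * 'X * q) : V).
  by rewrite /base_mul_s mulrCA.
by rewrite null2 !add0r.
Qed.

Definition form_mx (T : V -> V) : 'M[R]_(n + n) :=
  \matrix_(k, l) (G (monomial k) (T (monomial l))
    + G (monomial l) (T (monomial k))).

Lemma form_mx_sym T : (form_mx T)^T = form_mx T.
Proof. by apply/matrixP => k l; rewrite !mxE addrC. Qed.

Lemma form_mxE T v : linear T ->
  (v *m form_mx T *m v^T) 0 0 = 2 * G (comb v) (T (comb v)).
Proof.
move=> Tl.
have T0 : T 0 = 0 by have := Tl (-1) 0 0; rewrite scaler0 addr0 scaleN1r => ->; rewrite addNr.
have Tsum : T (comb v) = \sum_k v 0 k *: T (monomial k).
  rewrite /comb; elim: (index_enum _) => [|k r IH]; first by rewrite !big_nil.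
  by rewrite !big_cons Tl IH.
have h : G (comb v) (T (comb v)) =
    \sum_k \sum_l v 0 k * v 0 l * G (monomial k) (T (monomial l)).
  rewrite {1}/comb Tsum (si_suml Gsi); apply: eq_bigr => k _.
  rewrite (siZl Gsi) (si_sumr Gsi) mulr_sumr.
  by apply: eq_bigr => l _; rewrite (siZ Gsi) mulrA.
rewrite mulr2n mulrDl mul1r {2}h exchange_big /= h -big_split /= [LHS]mxE.
under [LHS]eq_bigr do rewrite !mxE mulr_suml.
rewrite exchange_big /=; apply: eq_bigr => k _; rewrite -big_split /=.
by apply: eq_bigr => l _; rewrite !mxE; ring.
Qed.

(** The factors 2 match [compression_le]; multiplication by conj z * s is Re z
    times [base_mul_s 1] plus Im z times [base_mul_s 'i] ([base_mul_sE]). *)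
Definition pencil (t x y : R) : 'M[R]_(n + n) :=
  t *: form_mx id - (2 * x) *: form_mx (@base_mul_s R 1)
   - (2 * y) *: form_mx (@base_mul_s R 'i%C).

Lemma pencilZ r t x y : pencil (r * t) (r * x) (r * y) = r *: pencil t x y.
Proof.
rewrite /pencil; move: (form_mx id) (form_mx (@base_mul_s R 1)) (form_mx (@base_mul_s R 'i%C)).
by move=> A B D; rewrite !scalerBr !scalerA 2![r * (2 * _)]mulrCA.
Qed.

Lemma pencilD t x y t' x' y' :
  pencil (t + t') (x + x') (y + y') = pencil t x y + pencil t' x' y'.
Proof.
rewrite /pencil; move: (form_mx id) (form_mx (@base_mul_s R 1)) (form_mx (@base_mul_s R 'i%C)).
by move=> A B D; apply/matrixP => i j; rewrite !mxE; ring.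
Qed.

Lemma pencil_sym t x y : (pencil t x y)^T = pencil t x y.
Proof.
have sym T := form_mx_sym T; move: (sym id) (sym (@base_mul_s R 1)).
rewrite /pencil; move: (sym (@base_mul_s R 'i%C)) => {sym}.
move: (form_mx id) (form_mx (@base_mul_s R 1)) (form_mx (@base_mul_s R 'i%C)) => A B D dD dA dB.
by rewrite !linearB !linearZ /= dA dB dD.
Qed.

Lemma pencilE t (z : C) v :
  (v *m pencil t (complex.Re z) (complex.Im z) *m v^T) 0 0
  = 2 * (t * G (comb v) (comb v)
         - 2 * G (comb v) (base_mul_s z (comb v))).
Proof.
have quad (A B D : 'M[R]_(n + n)) a b d : (v *m (a *: A - b *: B - d *: D) *m v^T) 0 0
    = a * (v *m A *m v^T) 0 0 - b * (v *m B *m v^T) 0 0 - d * (v *m D *m v^T) 0 0.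
  by rewrite !mulmxBr !mulmxBl -!scalemxAr -!scalemxAl !mxE.
have lin_id : linear (id : V -> V) by [].
have -> := quad (form_mx id) (form_mx (@base_mul_s R 1))
  (form_mx (@base_mul_s R 'i%C)) t (2 * complex.Re z) (2 * complex.Im z).
move: (form_mxE v lin_id) (form_mxE v (base_mul_s_linear 1))
  (form_mxE v (base_mul_s_linear 'i%C)).
move: (form_mx id) (form_mx (@base_mul_s R 1)) (form_mx (@base_mul_s R 'i%C)).
move=> A B D -> -> ->; rewrite (form_mul_s z).
move: (G _ (base_mul_s 1 _)) (G _ (base_mul_s 'i%C _)) => g1 gi.
by move: (G _ _) => g; ring.
Qed.

Lemma pencil0E t v :
  (v *m pencil t 0 0 *m v^T) 0 0 = 2 * (t * G (comb v) (comb v)).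
Proof.
have lin_id : linear (id : V -> V) by [].
rewrite /pencil mulr0 !scale0r !subr0 -scalemxAr -scalemxAl mxE.
by move: (form_mxE v lin_id); move: (form_mx id) => A ->; rewrite mulrCA.
Qed.

End FiniteForm.

Section SpectralForm.
Variables (R : realType) (F : {poly {poly R[i]}}) (n : nat).
Local Notation C := R[i].
Local Notation V := (base_space R).
Hypothesis Fm : F \is monic.
Hypothesis sF : size F = n.+1.
Hypothesis curve : forall w s : C, `|w| = 1 -> s \in fibre F w -> s = w * s^*.

(** It only refers to the curve: the rotations by z0 and w0 change neither b nor
    the constant terms.  Hence [compression_le] at all points of the circle is
    about one form, and is linear in (x, y). *)
Definition spectral_form (u x : V) : R := min_form (curve_form F) (@const_coef R) u x.

Lemma spectral_form_si : semi_inner spectral_form.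
Proof. exact: (min_form_si (curve_shift Fm curve (normr1 _))). Qed.

(** F(s, w) g(s) has constant term F(s, 0) g(s) and vanishes on the curve. *)
Lemma spectral_form_null (g : {poly C}) (x : V) :
  spectral_form (map_poly (horner_eval 0) F * g) x = 0.
Proof.
have sP := curve_shift Fm curve (normr1 _).
pose p : curve_space R := swapXY F * g%:P.
have pE : const_coef p = map_poly (horner_eval 0) F * g.
  by rewrite /const_coef coefMC -horner_coef0 -polyC0 horner_polyC swapXYK.
have p0 : curve_form F p p = 0.
  have -> : curve_form F p p = curve_form F 0 p.
    apply: curve_form_ext => w s w1 sw; congr complex.Re.
    rewrite /ev /p !hornerM horner_polyC swapXYK !horner0 rmorph0 mul0r.
    have /rootP -> : root (map_poly (horner_eval w) F) s.
      by rewrite (fibreE Fm) root_prod_XsubC.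
    by rewrite !mul0r mulr0.
  exact: (si0l (curve_form_si Fm curve)).
have := min_form_le sP p; rewrite /= pE p0 -/(spectral_form _ _) => h.
have := si_cauchy spectral_form_si (map_poly (horner_eval 0) F * g) x.
have -> : seminorm spectral_form (map_poly (horner_eval 0) F * g) = 0.
  apply/eqP; rewrite sqrtr_eq0; exact: h.
by rewrite mul0r normr_le0 => /eqP.
Qed.

Let F0 := map_poly (horner_eval 0) F.

Let F0m : F0 \is monic. Proof. exact: monic_map. Qed.

Let sF0 : size F0 = n.+1.
Proof. by rewrite size_map_poly_id0 // (monicP Fm) rmorph1 oner_neq0. Qed.

Local Notation fpencil := (@pencil R spectral_form n).
Let reduce := comb_reduce spectral_form_si F0m sF0 spectral_form_null.
Let fpencilE := @pencilE R spectral_form spectral_form_si n.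

Lemma psd_pencil_unit t (z : C) : `|z| = 1 ->
  (forall v : 'rV_(n + n), 0 <= (v *m fpencil t (complex.Re z) (complex.Im z) *m v^T) 0 0) <->
  (forall s, s \in fibre F (z ^+ 2) -> complex.Re (z^* * s) <= t).
Proof.
move=> z1.
have w1 : `|z ^+ 2| = 1 by rewrite normrX z1 expr1n.
rewrite (fibre_le_iff_compression_le Fm curve w1 (erefl _)); split => [h u|h v].
  have [v [e1 e2]] := reduce u.
  rewrite -/(spectral_form _ _) -/(spectral_form u u) -e1 -e2.
  by have := h v; rewrite fpencilE; lra.
by rewrite fpencilE; have := h (comb v); rewrite -!/(spectral_form _ _); lra.
Qed.

(** For t < 0 semidefiniteness forces G = 0.  Then [compression_le] holds with
    every bound, so the roots over w = 1 would lie below every real number. *)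
Lemma psd_pencil_scalar t : (0 < n)%N ->
  (forall v : 'rV_(n + n), 0 <= (v *m fpencil t 0 0 *m v^T) 0 0) <-> 0 <= t.
Proof.
move=> n0.
have E v := @pencil0E R spectral_form spectral_form_si n t v.
split=> [h|t0 v]; last by rewrite E mulr_ge0 // mulr_ge0 // (si_ge0 spectral_form_si).
rewrite leNgt; apply/negP => tneg.
have G0 u : spectral_form u u = 0.
  have [v [e1 _]] := reduce u.
  have := h v; rewrite E e1; have := si_ge0 spectral_form_si u; nra.
have [s sw] : exists s, s \in fibre F (1 ^+ 2).
  have := size_fibre Fm (1 ^+ 2); rewrite sF => -[].
  by case: (fibre F _) => [|s r] E'; [rewrite E' in n0 | exists s; rewrite mem_head].
have := (psd_pencil_unit (complex.Re s - 1) (normr1 C)).1.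
move=> /(_ _ s sw); rewrite rmorph1 mul1r => H.
suff : complex.Re s <= complex.Re s - 1 by lra.
apply: H => v; rewrite fpencilE G0 mulr0.
have -> : spectral_form (comb v) (base_mul_s 1 (comb v)) = 0.
  apply/eqP; rewrite -normr_le0 (le_trans (si_cauchy spectral_form_si _ _)) //.
  by rewrite /seminorm G0 sqrtr0 mul0r.
by rewrite mulr0 subrr mulr0.
Qed.

End SpectralForm.

(** * Ternary forms and their curves *)

Section Forms.
Variables (R : realType) (f : {poly3 R}) (n : nat).
Hypothesis fn : {in mpoly.msupp f, forall m, mpoly.mdeg m = n}.

Lemma rmorph_mmap (A B : comNzRingType) (phi : {rmorphism R -> A})
    (g : {rmorphism A -> B}) (h : 'I_3 -> A) :
  g (mpoly.mmap phi h f) = mpoly.mmap (g \o phi) (g \o h) f.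
Proof.
rewrite /mpoly.mmap rmorph_sum; apply: eq_bigr => m _.
rewrite rmorphM /mpoly.mmap1 rmorph_prod; congr (_ * _).
by apply: eq_bigr => i _; rewrite rmorphXn.
Qed.

Lemma eq_mmap (A : comNzRingType) (phi psi : R -> A) (h h' : 'I_3 -> A) :
  phi =1 psi -> h =1 h' -> mpoly.mmap phi h f = mpoly.mmap psi h' f.
Proof.
move=> p hh; rewrite /mpoly.mmap; apply: eq_bigr => m _.
by rewrite p; congr (_ * _); apply: eq_bigr => i _; rewrite hh.
Qed.

Lemma mmap_homog (A : comNzRingType) (phi : R -> A) (h : 'I_3 -> A) c :
  mpoly.mmap phi (fun i => c * h i) f = c ^+ n * mpoly.mmap phi h f.
Proof.
rewrite /mpoly.mmap mulr_sumr !big_seq; apply: eq_bigr => m /fn mn.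
rewrite mulrCA; congr (_ * _); rewrite /mpoly.mmap1 -mn mpoly.mdegE.
rewrite -prodrXr -big_split /=; apply: eq_bigr => i _; exact: exprMn.
Qed.

Lemma top_coefM (A : nzRingType) (p q : {poly A}) i j :
  (size p <= i.+1)%N -> (size q <= j.+1)%N ->
  (size (p * q)%R <= (i + j).+1)%N /\ (p * q)`_(i + j) = p`_i * q`_j.
Proof.
move=> sp sq; split.
  by rewrite (leq_trans (size_polyMleq _ _)) //; lia.
have ij : (i < (i + j).+1)%N by rewrite ltnS leq_addr.
rewrite coefM (bigD1 (Ordinal ij)) //= addKn big1 ?addr0 // => k.
rewrite -val_eqE /= neq_ltn => /orP[ki|ik].
  by rewrite (leq_sizeP _ _ sq) ?mulr0 //; have := ltn_ord k; lia.
by rewrite (leq_sizeP _ _ sp) ?mul0r.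
Qed.

Lemma mmap_line_top (A : comNzRingType) (phi : {rmorphism R -> A})
    (e : 'rV[R]_3) (c : 'I_3 -> A) :
  let L := mpoly.mmap (polyC \o phi) (fun i => (phi (e 0 i))%:P * 'X + (c i)%:P) f in
  (size L <= n.+1)%N /\ L`_n = phi (eval3 f e).
Proof.
set h := fun i => _; move=> L.
have hs i : (size (h i) <= 2)%N.
  rewrite (leq_trans (size_polyD _ _)) // geq_max !size_polyC.
  rewrite (leq_trans (size_polyMleq _ _)) ?size_polyC ?size_polyX //=; lia.
have h1 i : (h i)`_1 = phi (e 0 i).
  by rewrite coefD coefCM coefX coefC /= addr0 mulr1.
have pow i k : (size (h i ^+ k)%R <= k.+1)%N /\ (h i ^+ k)`_k = phi (e 0 i) ^+ k.
  elim: k => [|k [IH1 IH2]]; first by rewrite !expr0 size_poly1 coefC.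
  have [s1 s2] := top_coefM (hs i) IH1; rewrite add1n in s1 s2.
  by rewrite !exprS s2 h1 IH2.
have mon m : (size (mpoly.mmap1 h m) <= (mpoly.mdeg m).+1)%N /\
    (mpoly.mmap1 h m)`_(mpoly.mdeg m) = \prod_i phi (e 0 i) ^+ m i.
  rewrite mpoly.mdegE /mpoly.mmap1.
  elim: (index_enum _) => [|i r [IH1 IH2]].
    by rewrite !big_nil size_poly1 coefC.
  rewrite !big_cons; have [p1 p2] := pow i (m i).
  have [s1 s2] := top_coefM p1 IH1.
  by rewrite s1 s2 p2 IH2.
split.
  rewrite /L /mpoly.mmap (leq_trans (size_sum _ _ _)) //.
  apply/bigmax_leqP_seq => m /fn mn _.
  rewrite (leq_trans (size_polyMleq _ _)) //=.
  have [] := mon m; rewrite mn => sm _.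
  by rewrite -subn1 leq_subLR; exact: (leq_add (size_polyC_leq1 _) sm).
rewrite /L /mpoly.mmap coef_sum /eval3 mpoly.mevalE rmorph_sum !big_seq.
apply: eq_bigr => m /fn mn; rewrite coefCM rmorphM rmorph_prod; congr (_ * _).
by have [_] := mon m; rewrite mn => ->; apply: eq_bigr => i _; rewrite rmorphXn.
Qed.

Lemma eval3_homog c v : eval3 f (c *: v) = c ^+ n * eval3 f v.
Proof.
rewrite /eval3 /mpoly.meval -mmap_homog; apply: eq_mmap => // i.
by rewrite mxE.
Qed.

Definition evalC (h : 'I_3 -> R[i]) : R[i] := mpoly.mmap (real_complex R) h f.

Lemma evalC_real (v : 'rV[R]_3) (h : 'I_3 -> R[i]) :
  (forall i, h i = (v 0 i)%:C%C) -> evalC h = (eval3 f v)%:C%C.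
Proof.
move=> hv; rewrite /evalC /eval3 /mpoly.meval rmorph_mmap.
by apply: eq_mmap => // i; rewrite hv.
Qed.

End Forms.

Section Plane.
Variables (R : realType) (f : {poly3 R}) (n : nat) (e b1 b2 : 'rV[R]_3).
Local Notation C := R[i].
Hypothesis fn : {in mpoly.msupp f, forall m, mpoly.mdeg m = n}.
Hypothesis f_hyp : hyperbolic f e.
Hypothesis n0 : (0 < n)%N.

(** With w = z^2 and |z| = 1, (w + 1) / 2 = z Re z and i (1 - w) / 2 = z Im z, so
    this is z times the point Re z b1 + Im z b2 of the unit circle, written as a
    polynomial in w. *)
Definition arc (i : 'I_3) : {poly C} :=
  ((b1 0 i)%:C%C / 2)%:P * ('X + 1) + ((b2 0 i)%:C%C * 'i%C / 2)%:P * (1 - 'X).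

Definition curve_poly : {poly {poly C}} :=
  ((eval3 f e)^-1)%:C%C%:P%:P * mpoly.mmap (polyC \o (polyC \o real_complex R))
    (fun i => ((e 0 i)%:C%C%:P)%:P * 'X + (arc i)%:P) f.

Lemma curve_poly_top : curve_poly \is monic /\ size curve_poly = n.+1.
Proof.
have [s t] := mmap_line_top fn (polyC \o real_complex R) e arc.
have h1 : curve_poly`_n = 1.
  rewrite coefCM t /= -polyCM -rmorphM mulVf ?rmorph1 //; exact: f_hyp.1.
have h2 : (size curve_poly <= n.+1)%N.
  rewrite /curve_poly mul_polyC; exact: leq_trans (size_scale_leq _ _) s.
have h3 : size curve_poly = n.+1.
  apply/eqP; rewrite eqn_leq h2 /= ltnNge; apply/negP => /leq_sizeP /(_ n (leqnn n)).
  by move/eqP; rewrite h1 oner_eq0.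
by split=> //; rewrite monicE lead_coefE h3 /= h1.
Qed.

Definition plane_pt (z t : C) (i : 'I_3) : C :=
  t * (e 0 i)%:C%C + (complex.Re z * b1 0 i + complex.Im z * b2 0 i)%:C%C.

(** F(z t, z^2) = z^n f(t e + Re z b1 + Im z b2) / f(e). *)
Lemma mem_fibre (z t : C) : `|z| = 1 ->
  (z * t \in fibre curve_poly (z ^+ 2)) = (evalC f (plane_pt z t) == 0).
Proof.
move=> z1; have zz : z * z^* = 1 by exact: unit_conjM.
have Fm := curve_poly_top.1.
rewrite -root_prod_XsubC -(fibreE Fm) /root /curve_poly.
rewrite rmorphM hornerM /= map_polyC /= hornerC /horner_eval hornerC.
rewrite -/(horner_eval (z * t) _) -[map_poly _ _]/(map_poly (horner_eval (z ^+ 2)) _).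
rewrite mulf_eq0 [X in X || _](_ : _ = false) /=; last first.
  by apply/negbTE; rewrite eq_complex /= eqxx andbT invr_eq0; exact: f_hyp.1.
rewrite (rmorph_mmap f (polyC \o (polyC \o real_complex R)) (map_poly (horner_eval (z ^+ 2)))).
rewrite (rmorph_mmap f (map_poly (horner_eval (z ^+ 2)) \o (polyC \o (polyC \o real_complex R)))
  (horner_eval (z * t))).
have scaled (x y : C) : x = z ^+ n * y -> (x == 0) = (y == 0).
  move=> ->; rewrite mulf_eq0 expf_eq0.
  by rewrite -[z == 0]normr_eq0 z1 oner_eq0 andbF.
apply: scaled; rewrite /evalC -(mmap_homog fn); apply: eq_mmap => [c|i] /=.
  by rewrite map_polyC /= /horner_eval !hornerC.
rewrite rmorphD rmorphM /= !map_polyC map_polyX /= /horner_eval !hornerE /=.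
rewrite /plane_pt rmorphD !rmorphM /= ReJ_add ImJ_sub.
rewrite -/(z^*).
set B1 := (b1 0 i)%:C%C; set B2 := (b2 0 i)%:C%C; set E := (e 0 i)%:C%C.
transitivity (E * z * t + B1 / 2 * (z * z + z * z^*)
  + B2 * 'i%C / 2 * (z * z^* - z * z)); first by rewrite zz; ring.
by ring.
Qed.

Lemma root_plane (z t : C) : root (map_poly (real_complex R)
    (line_poly f e (complex.Re z *: b1 + complex.Im z *: b2))) t
  = (evalC f (plane_pt z t) == 0).
Proof.
rewrite /root /line_poly; congr (_ == 0).
rewrite (rmorph_mmap f polyC (map_poly (real_complex R))).
rewrite -/(horner_eval t _).
rewrite (rmorph_mmap f (map_poly (real_complex R) \o polyC) (horner_eval t)).
apply: eq_mmap => [c|i] /=; first by rewrite map_polyC /= /horner_eval hornerC.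
rewrite rmorphD /= map_polyZ map_polyX map_polyC /= /horner_eval !hornerE.
by rewrite !mxE /plane_pt mulrC.
Qed.

Lemma plane_real (z t : C) : evalC f (plane_pt z t) = 0 -> t = (complex.Re t)%:C%C.
Proof.
move=> ft; have := f_hyp.2 (complex.Re z *: b1 + complex.Im z *: b2) t.
rewrite root_plane ft eqxx => /(_ isT) It.
by apply/eqP; rewrite eq_complex /= It !eqxx.
Qed.

Lemma curve_poly_real (w s : C) : `|w| = 1 -> s \in fibre curve_poly w -> s = w * s^*.
Proof.
move=> w1; have [z zw] : exists z, z ^+ 2 = w by exists (sqrtC w); rewrite sqrtCK.
have z1 : `|z| = 1 by apply/eqP; rewrite -(@pexpr_eq1 _ _ 2) // -normrX zw w1.
have zz : z * z^* = 1 by exact: unit_conjM.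
have -> : s = z * (z^* * s) by rewrite mulrA zz mul1r.
set t := z^* * s; rewrite -{1}zw mem_fibre // => /eqP /plane_real tE.
have tJ : t^* = t by rewrite {1}tE [LHS]conjc_real -tE.
rewrite -zw rmorphM /= tJ expr2.
by transitivity (z * (z * z^*) * t); [rewrite zz mulr1 | ring].
Qed.

Local Notation fpencil := (@pencil R (spectral_form curve_poly) n).

Lemma plane_pt_real (z : C) (mu : R) : evalC f (plane_pt z mu%:C%C) =
  (eval3 f (mu *: e + (complex.Re z *: b1 + complex.Im z *: b2)))%:C%C.
Proof.
by apply: evalC_real => i; rewrite /plane_pt !mxE -rmorphM -rmorphD.
Qed.

Lemma psd_plane_unit tau (z : C) : `|z| = 1 ->
  (forall v : 'rV_(n + n),
     0 <= (v *m fpencil tau (complex.Re z) (complex.Im z) *m v^T) 0 0) <->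
  (forall mu, tau < mu ->
     eval3 f (mu *: e + (complex.Re z *: b1 + complex.Im z *: b2)) != 0).
Proof.
move=> z1; have [Fm sF] := curve_poly_top.
have zz : z^* * z = 1 by exact: sqr_norm_unit.
rewrite (psd_pencil_unit Fm sF curve_poly_real tau z1); split=> [h mu|h s].
  apply: contraTneq => fmu; rewrite -leNgt.
  have := h (z * mu%:C%C); rewrite mem_fibre // plane_pt_real fmu eqxx.
  by rewrite mulrA zz mul1r; apply.
have -> : s = z * (z^* * s) by rewrite mulrA [z * _]mulrC zz mul1r.
rewrite mem_fibre // mulrA zz mul1r => /eqP ft.
rewrite leNgt; apply/negP => /h /negP; apply.
have := ft; rewrite {1}(plane_real ft) plane_pt_real => /eqP.
by rewrite eq_complex /= eqxx andbT.
Qed.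

(** Both sides are homogeneous, so (x, y), unless it is 0, can be scaled to the
    unit circle. *)
Lemma psd_plane tau x y :
  (forall v : 'rV_(n + n), 0 <= (v *m fpencil tau x y *m v^T) 0 0) <->
  (forall mu, tau < mu -> eval3 f (mu *: e + (x *: b1 + y *: b2)) != 0).
Proof.
have [Fm sF] := curve_poly_top.
have [r0|r0] := eqVneq (x ^+ 2 + y ^+ 2) 0.
  have [-> ->] : x = 0 /\ y = 0.
    by move/eqP: r0; rewrite paddr_eq0 ?sqr_ge0 // !sqrf_eq0 => /andP[/eqP -> /eqP ->].
  rewrite (psd_pencil_scalar Fm sF curve_poly_real tau n0) !scale0r !addr0.
  split=> [t0 mu tmu|h].
    rewrite addr0 (eval3_homog fn) mulf_neq0 ?f_hyp.1 // expf_neq0 // gt_eqF //.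
    exact: le_lt_trans tmu.
  rewrite leNgt; apply/negP => /h; rewrite addr0 (eval3_homog fn).
  by rewrite expr0n gtn_eqF // mul0r eqxx.
pose r := Num.sqrt (x ^+ 2 + y ^+ 2).
have r2 : r ^+ 2 = x ^+ 2 + y ^+ 2 by rewrite sqr_sqrtr // addr_ge0 ?sqr_ge0.
have rpos : 0 < r by rewrite sqrtr_gt0 lt_def r0 addr_ge0 ?sqr_ge0.
have rn0 : r != 0 by rewrite gt_eqF.
pose z : C := Complex (x / r) (y / r).
have z1 : `|z| = 1.
  rewrite normc_def /= !expr_div_n -mulrDl -r2 divff ?sqrtr1 //.
  by rewrite expf_neq0.
have xE : x = r * (x / r) by rewrite mulrCA divff ?mulr1.
have yE : y = r * (y / r) by rewrite mulrCA divff ?mulr1.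
have tE : tau = r * (tau / r) by rewrite mulrCA divff ?mulr1.
have pE : fpencil tau x y = r *: fpencil (tau / r) (complex.Re z) (complex.Im z).
  by rewrite -pencilZ /= -tE -xE -yE.
have qE (v : 'rV_(n + n)) : (v *m fpencil tau x y *m v^T) 0 0 =
    r * (v *m fpencil (tau / r) (complex.Re z) (complex.Im z) *m v^T) 0 0.
  by rewrite pE -scalemxAr -scalemxAl mxE.
have fE mu : eval3 f (mu *: e + (x *: b1 + y *: b2)) =
    r ^+ n * eval3 f ((mu / r) *: e + (complex.Re z *: b1 + complex.Im z *: b2)).
  by rewrite -(eval3_homog fn) !scalerDr !scalerA -xE -yE mulrCA divff ?mulr1.
have -> : (forall v : 'rV_(n + n), 0 <= (v *m fpencil tau x y *m v^T) 0 0) <->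
   (forall v : 'rV_(n + n),
     0 <= (v *m fpencil (tau / r) (complex.Re z) (complex.Im z) *m v^T) 0 0).
  by split=> h v; have := h v; rewrite qE pmulr_rge0.
rewrite psd_plane_unit //; split=> h mu hmu.
  by rewrite fE mulf_neq0 ?expf_neq0 // h // ltr_pM2r ?invr_gt0.
have := h (r * mu); rewrite -ltr_pdivrMl // [r^-1 * _]mulrC => /(_ hmu).
by rewrite fE mulf_eq0 negb_or mulrAC divff // mul1r => /andP[].
Qed.

End Plane.

(** * The closed cone as a spectrahedron *)

Section Cone.
Variables (R : realType) (f : {poly3 R}) (n : nat) (e : 'rV[R]_3).
Hypothesis fn : {in mpoly.msupp f, forall m, mpoly.mdeg m = n}.

Definition closed_cone : set 'rV[R]_3 :=
  [set a | forall t, t < 0 -> eval3 f (t *: e - a) != 0].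

Lemma hyperbolicity_coneW : hyperbolicity_cone f e `<=` closed_cone.
Proof. by move=> a ha t t0; apply: ha; exact: ltW. Qed.

(** Moving a by d e adds d to all the roots t of f(t e - a). *)
Lemma closed_cone_shift a d : closed_cone a -> 0 < d ->
  hyperbolicity_cone f e (a + d *: e).
Proof.
move=> ha d0 t t0.
have -> : t *: e - (a + d *: e) = (t - d) *: e - a.
  by rewrite scalerBl opprD [- a - _]addrC addrA.
by apply: ha; rewrite subr_lt0 (le_lt_trans t0).
Qed.

Lemma closed_cone_closure : closed_cone `<=` closure (hyperbolicity_cone f e).
Proof.
move=> a ha B /nbhs_ballP[r /= r0 aB].
pose M := 1 + \sum_i `|e 0 i|.
have M0 : 0 < M by rewrite ltr_pwDl // sumr_ge0.
pose d := r / (2 * M).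
have d0 : 0 < d by rewrite divr_gt0 // mulr_gt0.
exists (a + d *: e); split; first exact: closed_cone_shift.
apply: aB; split=> // i j; rewrite ord1 /ball /= !mxE opprD addNKr normrN normrM.
have eM : `|e 0 j| <= M.
  rewrite /M (bigD1 j) //= addrCA lerDl addr_ge0 // sumr_ge0 //.
rewrite gtr0_norm // (le_lt_trans (ler_wpM2l (ltW d0) eM)) //.
have -> : d * M = r / 2 by rewrite /d; field; rewrite gt_eqF.
by rewrite gtr_pMr // invf_lt1 // ltr1n.
Qed.

Hypothesis f_hyp : hyperbolic f e.
Hypothesis n0 : (0 < n)%N.

(** A coordinate k with e_k <> 0 completes e to a basis by the two other unit
    vectors. *)
Variable k : 'I_3.
Hypothesis ek : e 0 k != 0.

Let i1 : 'I_3 := lift k (ord0 : 'I_2).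
Let i2 : 'I_3 := lift k (ord_max : 'I_2).

Definition height (v : 'rV[R]_3) : R := v 0 k / e 0 k.
Definition plane_coord (i : 'I_3) (v : 'rV[R]_3) : R := v 0 i - height v * e 0 i.

Lemma coord_decomposition v : v = height v *: e +
  (plane_coord i1 v *: delta_mx 0 i1 + plane_coord i2 v *: delta_mx 0 i2).
Proof.
apply/rowP => i; rewrite !mxE eqxx /=.
case: (unliftP k i) => [j ->|->].
  have [->|->] : j = ord0 \/ j = ord_max.
    by case: j => -[|[|//]] p; [left|right]; exact/val_inj.
  - have ne : (i1 == i2) = false by rewrite (inj_eq (@lift_inj _ k)).
    by rewrite -/i1 ne eqxx /plane_coord mulr1 mulr0; ring.
  - have ne : (i2 == i1) = false by rewrite (inj_eq (@lift_inj _ k)).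
    by rewrite -/i2 ne eqxx /plane_coord mulr1 mulr0; ring.
by rewrite !(negbTE (neq_lift _ _)) !mulr0 !addr0 /height mulfVK.
Qed.

Definition cone_mx (v : 'rV[R]_3) : 'M[R]_(n + n) :=
  pencil (spectral_form (curve_poly f e (delta_mx 0 i1) (delta_mx 0 i2))) n
    (height v) (plane_coord i1 v) (plane_coord i2 v).

Lemma cone_mx_linear : linear cone_mx.
Proof.
move=> c u v; rewrite /cone_mx -pencilZ -pencilD.
congr pencil; rewrite /plane_coord /height !mxE; ring.
Qed.

Lemma cone_mx_sum v : cone_mx v = \sum_i v 0 i *: cone_mx (delta_mx 0 i).
Proof.
have zero : cone_mx 0 = 0.
  by have := cone_mx_linear (-1) 0 0; rewrite scaler0 addr0 scaleN1r addNr.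
rewrite {1}(row_sum_delta v); elim: (index_enum _) => [|i r IH].
  by rewrite !big_nil.
by rewrite !big_cons cone_mx_linear IH.
Qed.

Lemma closed_coneE v : closed_cone v <-> psdmx (cone_mx v).
Proof.
have := @psd_plane R f n e (delta_mx 0 i1) (delta_mx 0 i2) fn f_hyp n0
  (height v) (plane_coord i1 v) (plane_coord i2 v).
rewrite -/(cone_mx v) => psdE.
have -> : psdmx (cone_mx v) <->
    (forall u : 'rV_(n + n), 0 <= (u *m cone_mx v *m u^T) 0 0).
  by split=> [[]|h] //; split=> //; exact: pencil_sym.
rewrite {}psdE.
have fE t : eval3 f (t *: e - v) = (- 1) ^+ n *
    eval3 f ((height v - t) *: e + (plane_coord i1 v *: delta_mx 0 i1
       + plane_coord i2 v *: delta_mx 0 i2)).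
  have gen (p : 'rV[R]_3) h : t *: e - (h *: e + p) = - ((h - t) *: e + p).
    by rewrite scalerBl !opprD opprK addrA [t *: e - _]addrC.
  by rewrite -(eval3_homog fn) scaleN1r {1}(coord_decomposition v) gen.
split=> [h mu hmu|h t t0].
  have := h (height v - mu); rewrite subr_lt0 fE => /(_ hmu).
  by rewrite mulf_eq0 negb_or subKr => /andP[].
rewrite fE mulf_neq0 ?expf_neq0 ?oppr_eq0 ?oner_eq0 //; apply: h.
by rewrite ltrBrDl gtrDr.
Qed.

Lemma closure_coneE :
  closure (hyperbolicity_cone f e) = [set v | psdmx (cone_mx v)].
Proof.
apply/seteqP; split=> v; last by move=> /closed_coneE /closed_cone_closure.
move=> hv; split; first exact: pencil_sym.
move=> u; pose g (v : 'rV[R]_3) := \sum_i v 0 i * (u *m cone_mx (delta_mx 0 i) *m u^T) 0 0.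
have gE x : (u *m cone_mx x *m u^T) 0 0 = g x.
  rewrite cone_mx_sum mulmx_sumr mulmx_suml summxE /g.
  by apply: eq_bigr => i _; rewrite -scalemxAr -scalemxAl mxE.
have gc : continuous g.
  rewrite /g; elim: (index_enum _) => [|i r IH].
    rewrite (_ : (fun _ => _) = cst 0); first exact: cst_continuous.
    by apply/funext => x; rewrite big_nil.
  pose c := (u *m cone_mx (delta_mx 0 i) *m u^T) 0 0.
  rewrite (_ : (fun _ => _) = (fun x : 'rV[R]_3 => x 0 i * c) \+ (fun x : 'rV[R]_3 =>
     \sum_(j <- r) x 0 j * (u *m cone_mx (delta_mx 0 j) *m u^T) 0 0)).
    move=> x; apply: continuousD; last exact: IH.
    by apply: continuousM; [exact: coord_continuous | exact: cst_continuous].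
  by apply/funext => x; rewrite big_cons.
have gcl : closed [set x | 0 <= g x].
  by apply: (@preimage_closed _ _ g [set y | 0 <= y]) => //; exact: closed_ge.
rewrite gE; apply: (gcl v); apply: closureS hv => x.
by move=> /hyperbolicity_coneW /closed_coneE [_ /(_ u)]; rewrite gE.
Qed.

End Cone.

Theorem corollary5p1 (R : realType) (f : {poly3 R}) (e : 'rV[R]_3)
    (f_homog : homogeneous f) (f_hyp : hyperbolic f e) :
  exists (m : nat) (N0 N1 N2 : 'M[R]_m),
    [/\ (1 <= m)%N, N0^T = N0, N1^T = N1, N2^T = N2 &
      closure (hyperbolicity_cone f e) =
        [set a : 'rV[R]_3 |
          psdmx (a 0 0 *: N0 + a 0 1 *: N1 + a 0 2%:R *: N2)]].
Proof.
have [n fn] : exists n, {in mpoly.msupp f, forall m, mpoly.mdeg m = n}.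
  by exists (mpoly.mmeasure mpoly.mdeg f).-1; exact/mpoly.dhomogP.
have [n0|n0] := posnP n.
  exists 1%N, 0, 0, 0; rewrite trmx0; split=> //.
  have -> : hyperbolicity_cone f e = setT.
    apply/seteqP; split=> // a _ t _.
    have const v : eval3 f v = eval3 f 0.
      by rewrite -(scale0r v) (eval3_homog fn) n0 expr0 mul1r.
    by rewrite const -(const e); exact: f_hyp.1.
  rewrite closureT; apply/seteqP; split=> // a _ /=.
  rewrite !scaler0 !addr0; split; first by rewrite trmx0.
  by move=> v; rewrite mulmx0 mul0mx mxE.
have [k ek] : exists k, e 0 k != 0.
  apply/existsP; apply: contraT; rewrite negb_exists => /forallP h.
  have e0 : e = 0.
    by apply/rowP => i; rewrite mxE; have := h i; rewrite negbK => /eqP.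
  have := f_hyp.1; rewrite e0 -(scale0r 0) (eval3_homog fn).
  by rewrite expr0n gtn_eqF // mul0r eqxx.
pose N := cone_mx f n e k.
exists (n + n)%N, (N (delta_mx 0 0)), (N (delta_mx 0 1)), (N (delta_mx 0 2%:R)).
split; try exact: pencil_sym; first by rewrite addn_gt0 n0.
rewrite (closure_coneE fn f_hyp n0 ek); apply/seteqP.
have NE (a : 'rV[R]_3) : a 0 0 *: N (delta_mx 0 0) + a 0 1 *: N (delta_mx 0 1)
    + a 0 2%:R *: N (delta_mx 0 2%:R) = N a.
  rewrite [in RHS]/N cone_mx_sum !big_ord_recl big_ord0 addr0 addrA.
  have -> : lift ord0 ord0 = 1 :> 'I_3 by exact/val_inj.
  by have -> : lift ord0 (lift ord0 ord0) = 2%:R :> 'I_3 by exact/val_inj.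
by split=> a /=; rewrite NE.
Qed.
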